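(* Consider the split system $g(p,x)=(g_1(p,x),g_2(p,x))\in C_1\times C_2=C$ with $g_i:P\times\mathbb{R}^n\to\mathbb{R}^{l_i}$, closed $C_i\subset\mathbb{R}^{l_i}$, $l_1+l_2=l$, satisfying the standing assumptions at $(\bar p,\bar x)\in\operatorname{gph}\Gamma$. Let $\zeta:P\to\mathbb{R}$ be continuous at $\bar p$ and let $D:=D^{\mathrm{Im}}_{p,\zeta}g(\bar p,\bar x)$. Assume: (a) for every $v\in D$ and every sequence $t_k\downarrow0$ there is $u\in\mathbb{R}^n$ with $\liminf_{k\to\infty}\operatorname{dist}\big(g(\bar p,\bar x)+t_k(v+\nabla_xg(\bar p,\bar x)u);C\big)/t_k=0$; (b) Robinson stability holds at $(\bar p,\bar x)$ for the subsystem $g_2(p,x)\in C_2$; (c) for every $(v,u)\in D\times\mathbb{R}^n$ with $(v,u)\neq(0,0)$ and $v+\nabla_xg(\bar p,\bar x)u\in T_C(g(\bar p,\bar x))$, writing $v=(v_1,v_2)\in\mathbb{R}^{l_1}\times\mathbb{R}^{l_2}$, the implication $$\Big[\lambda=(\lambda^1,\lambda^2)\in\prod_{i=1}^2N_{C_i}\big(g_i(\bar p,\bar x);v_i+\nabla_xg_i(\bar p,\bar x)u\big),\ \nabla_xg(\bar p,\bar x)^T\lambda=0\Big]\Longrightarrow\lambda^1=0$$ holds. Then Robinson stability holds at $(\bar p,\bar x)$ for the whole system $g(p,x)\in C$.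
   Context: $P$ is a topological space, $\Gamma(p)=\{x:g(p,x)\in C\}$. Standing assumptions: there are neighborhoods $U$ of $\bar x$ and $V$ of $\bar p$ such that for each $p\in V$ the map $g(p,\cdot)$ is continuously differentiable on $U$, and $g$, $\nabla_x g$ are continuous at $(\bar p,\bar x)$. Robinson stability of a system $h(p,x)\in K$ at $(\bar p,\bar x)$: there exist $\kappa\ge0$ and neighborhoods $U$ of $\bar x$, $V$ of $\bar p$ with $\operatorname{dist}(x;\{\xi:h(p,\xi)\in K\})\le\kappa\operatorname{dist}(h(p,x);K)$ for all $(p,x)\in V\times U$. Image derivative $D^{\mathrm{Im}}_{p,\zeta}g(\bar p,\bar x)$: the smallest closed cone containing $0$ and all $v\in\mathbb{R}^l$ for which there is a sequence $p_k\in P$ with $0<\|g(p_k,\bar x)-g(\bar p,\bar x)\|<1/k$, $\|\nabla_xg(p_k,\bar x)-\nabla_xg(\bar p,\bar x)\|<1/k$, $|\zeta(p_k)-\zeta(\bar p)|<1/k$ and $v=\lim_k (g(p_k,\bar x)-g(\bar p,\bar x))/\|g(p_k,\bar x)-g(\bar p,\bar x)\|$. $T_C$ is the contingent cone. Directional limiting normal cone of a closed set $\Omega$ at $\bar z$ in direction $w$: $N_\Omega(\bar z;w)=\{v:\exists t_k\downarrow0,w_k\to w,v_k\to v,\ \bar z+t_kw_k\in\Omega,\ v_k\in\widehat N_\Omega(\bar z+t_kw_k)\}$, where $\widehat N_\Omega(z)$ is the regular (Fréchet) normal cone (polar of the contingent cone). *)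

(* Defs.v *)
From mathcomp Require Import all_boot.
From Stdlib Require Import Reals ClassicalEpsilon.

Set Implicit Arguments.
Unset Strict Implicit.
Unset Printing Implicit Defensive.

Local Open Scope R_scope.

Definition vec (n : nat) := 'I_n -> R.
Definition mat (m n : nat) := 'I_m -> 'I_n -> R.

Definition vzero n : vec n := fun _ => 0.
Definition vadd n (x y : vec n) : vec n := fun i => x i + y i.
Definition vsub n (x y : vec n) : vec n := fun i => x i - y i.
Definition vscal n (a : R) (x : vec n) : vec n := fun i => a * x i.
Definition dot n (x y : vec n) : R := \big[Rplus/0]_(i < n) (x i * y i).
Definition norm n (x : vec n) : R := sqrt (dot x x).

Definition mv m n (A : mat m n) (u : vec n) : vec m :=
  fun i => \big[Rplus/0]_(j < n) (A i j * u j).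
Definition mtv m n (A : mat m n) (lam : vec m) : vec n :=
  fun j => \big[Rplus/0]_(i < m) (A i j * lam i).
Definition msub m n (A B : mat m n) : mat m n := fun i j => A i j - B i j.
Definition mnorm m n (A : mat m n) : R :=
  sqrt (\big[Rplus/0]_(i < m) \big[Rplus/0]_(j < n) (A i j * A i j)).

Definition blk1 l1 l2 (y : vec (l1 + l2)) : vec l1 := fun i => y (lshift l2 i).
Definition blk2 l1 l2 (y : vec (l1 + l2)) : vec l2 := fun i => y (rshift l1 i).

Definition vconv n (s : nat -> vec n) (v : vec n) : Prop :=
  forall eps, 0 < eps -> exists N : nat, forall k : nat, (N <= k)%nat ->
    norm (vsub (s k) v) < eps.

Definition tdown (t : nat -> R) : Prop :=
  (forall k, 0 < t k) /\
  (forall eps, 0 < eps -> exists N : nat, forall k : nat, (N <= k)%nat -> t k < eps).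

Definition liminf_eq0 (a : nat -> R) : Prop :=
  (forall eps, 0 < eps -> forall N : nat, exists k : nat, (N <= k)%nat /\ a k < eps) /\
  (forall eps, 0 < eps -> exists N : nat, forall k : nat, (N <= k)%nat -> - eps < a k).

Definition is_closed n (S : vec n -> Prop) : Prop :=
  forall v, (forall eps, 0 < eps -> exists w, S w /\ norm (vsub w v) < eps) -> S v.

Definition is_cone n (K : vec n -> Prop) : Prop :=
  forall a v, 0 <= a -> K v -> K (vscal a v).

Definition nbhd_vec n (U : vec n -> Prop) (x : vec n) : Prop :=
  exists d, 0 < d /\ forall y, norm (vsub y x) < d -> U y.

(* distance to a set: the infimum of ||x - s|| over s in S
   (only meaningful for nonempty S; see robinson_stable for the convention
   dist(x; emptyset) = +infinity). *)
Definition is_dist n (x : vec n) (S : vec n -> Prop) (d : R) : Prop :=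
  (forall s, S s -> d <= norm (vsub x s)) /\
  (forall e, (forall s, S s -> e <= norm (vsub x s)) -> e <= d).
Definition setdist n (x : vec n) (S : vec n -> Prop) : R :=
  epsilon (inhabits 0) (is_dist x S).

Definition contingent n (S : vec n -> Prop) (z : vec n) (w : vec n) : Prop :=
  exists (t : nat -> R) (ws : nat -> vec n),
    tdown t /\ vconv ws w /\ forall k, S (vadd z (vscal (t k) (ws k))).

Definition reg_normal n (S : vec n -> Prop) (z : vec n) (v : vec n) : Prop :=
  forall w, contingent S z w -> dot v w <= 0.

Definition dir_normal n (S : vec n -> Prop) (zb w : vec n) (v : vec n) : Prop :=
  exists (t : nat -> R) (ws vs : nat -> vec n),
    tdown t /\ vconv ws w /\ vconv vs v /\
    forall k, S (vadd zb (vscal (t k) (ws k))) /\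
              reg_normal S (vadd zb (vscal (t k) (ws k))) (vs k).

Record topology (P : Type) := Topology {
  open : (P -> Prop) -> Prop;
  open_full : open (fun _ => True);
  open_inter : forall A B, open A -> open B -> open (fun p => A p /\ B p);
  open_union : forall (I : Type) (F : I -> P -> Prop),
      (forall i, open (F i)) -> open (fun p => exists i, F i p)
}.

Definition nbhd_P (P : Type) (T : topology P) (V : P -> Prop) (pb : P) : Prop :=
  exists O, open T O /\ O pb /\ forall p, O p -> V p.

Definition standing (P : Type) (T : topology P) n l
    (g : P -> vec n -> vec l) (Dg : P -> vec n -> mat l n) (pb : P) (xb : vec n) : Prop :=
  (exists U V, nbhd_vec U xb /\ nbhd_P T V pb /\
     forall p, V p ->
       (forall x, U x -> forall eps, 0 < eps -> exists d, 0 < d /\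
          forall h, norm h < d ->
            norm (vsub (vsub (g p (vadd x h)) (g p x)) (mv (Dg p x) h)) <= eps * norm h) /\
       (forall x, U x -> forall eps, 0 < eps -> exists d, 0 < d /\
          forall y, U y -> norm (vsub y x) < d -> mnorm (msub (Dg p y) (Dg p x)) < eps)) /\
  (forall eps, 0 < eps -> exists V d, nbhd_P T V pb /\ 0 < d /\
     forall p x, V p -> norm (vsub x xb) < d -> norm (vsub (g p x) (g pb xb)) < eps) /\
  (forall eps, 0 < eps -> exists V d, nbhd_P T V pb /\ 0 < d /\
     forall p x, V p -> norm (vsub x xb) < d -> mnorm (msub (Dg p x) (Dg pb xb)) < eps).

Definition cont_at (P : Type) (T : topology P) (zeta : P -> R) (pb : P) : Prop :=
  forall eps, 0 < eps -> exists V, nbhd_P T V pb /\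
    forall p, V p -> Rabs (zeta p - zeta pb) < eps.

(* dist(x; S(p)) <= kappa * setdist(h(p,x); K), with the convention
   dist(.; emptyset) = +infinity: if K is empty the inequality is trivially
   true; otherwise it requires S(p) nonempty and the real inequality. *)
Definition robinson_stable (P : Type) (T : topology P) n m
    (h : P -> vec n -> vec m) (K : vec m -> Prop) (pb : P) (xb : vec n) : Prop :=
  exists kappa U V, 0 <= kappa /\ nbhd_vec U xb /\ nbhd_P T V pb /\
    forall p x, V p -> U x ->
      (exists y, K y) ->
      (exists xi, K (h p xi)) /\
      setdist x (fun xi => K (h p xi)) <= kappa * setdist (h p x) K.

Definition im_gen (P : Type) n l (g : P -> vec n -> vec l) (Dg : P -> vec n -> mat l n)
    (zeta : P -> R) (pb : P) (xb : vec n) (v : vec l) : Prop :=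
  exists ps : nat -> P,
    (forall k : nat,
       0 < norm (vsub (g (ps k) xb) (g pb xb)) < / INR (k + 1) /\
       mnorm (msub (Dg (ps k) xb) (Dg pb xb)) < / INR (k + 1) /\
       Rabs (zeta (ps k) - zeta pb) < / INR (k + 1)) /\
    vconv (fun k => vscal (/ norm (vsub (g (ps k) xb) (g pb xb)))
                          (vsub (g (ps k) xb) (g pb xb))) v.

Definition im_deriv (P : Type) n l (g : P -> vec n -> vec l) (Dg : P -> vec n -> mat l n)
    (zeta : P -> R) (pb : P) (xb : vec n) (v : vec l) : Prop :=
  forall K : vec l -> Prop, is_closed K -> is_cone K -> K (@vzero l) ->
    (forall w, im_gen g Dg zeta pb xb w -> K w) -> K v.

(* Main.v *)
Require Import Defs.
From mathcomp Require Import all_boot.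
From Stdlib Require Import Reals Lra ClassicalEpsilon FunctionalExtensionality Classical.
From mathcomp Require Import Rstruct.
Local Open Scope R_scope.

Set Implicit Arguments.
Unset Strict Implicit.
Unset Printing Implicit Defensive.

(** If Robinson stability fails, there are parameters p -> pb and points x -> xb,
    feasible for the second block only, at which x' |-> dist(g1(p,x'); C1) +
    eps |x - x'| attains a positive minimum over the second feasible set, with
    eps -> 0 (Ekeland).  Penalizing the second constraint quadratically gives
    approximate multipliers lam that are regular normals at points of C, with
    |lam1| = 1, with lam2 bounded by stability of the second block, and with
    A^T lam -> 0 for A the derivative at (pb, xb).  Put
    t = |g(p,xb) - g(pb,xb)| + |x - xb|.  Assumption (a) supplies competitors
    showing that dist(g1(p,x); C1) = o(t), so the base points of the normals are
    g(pb,xb) + t (v + A u) + o(t) along a subsequence, with v in the image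
    derivative and (v,u) <> 0.  The limit of lam then contradicts (c). *)

(** * Euclidean vector algebra *)

(** The topology of the parameter space need not have a countable base, so failure of stability
    gives no sequence of parameters converging to [pb]. Only countably many accuracy requirements on
    p matter (linearization, value, derivative and [zeta] within 1/(k+1)); they define neighborhoods
    [W k], and failure makes each member of a decreasing family [bad k] of data nonempty. Clustering
    works on that family; sequences are chosen from it only where (a), the image derivative or the
    normal cones require them. The blocks are treated differently on purpose. The distance to C1
    enters unsquared, so wherever it is positive its multiplier is a unit vector, which (c) cannot
    tolerate in the limit. The distance to C2 enters squared, and only (b) keeps its multiplier
    bounded. Assumption (a) is applied to a limit w of the directions of g(p,xb) - g(pb,xb), with
    the lengths of these vectors as step sizes, whereas base points are normalized by t. The limit
    sigma in [0,1] of the ratio of the two lengths reconciles them: v = sigma w is in the image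
    derivative, a cone, even if sigma = 0. *)

Notation "\rsum_ ( i < n ) F" := (\big[Rplus/0]_(i < n) F)
  (at level 41, F at level 41, i, n at level 50).

Lemma rsumD n (F G : 'I_n -> R) :
  \rsum_(i < n) (F i + G i) = \rsum_(i < n) F i + \rsum_(i < n) G i.
Proof. exact: big_split. Qed.

Lemma rsumZ n c (F : 'I_n -> R) : \rsum_(i < n) (c * F i) = c * \rsum_(i < n) F i.
Proof. by rewrite big_distrr. Qed.

Lemma rsum_le n (F G : 'I_n -> R) :
  (forall i, F i <= G i) -> \rsum_(i < n) F i <= \rsum_(i < n) G i.
Proof. by move=> h; elim/big_ind2: _ => //; [lra | move=> *; lra]. Qed.

Lemma rsum_ge0 n (F : 'I_n -> R) : (forall i, 0 <= F i) -> 0 <= \rsum_(i < n) F i.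
Proof. by move=> h; elim/big_ind: _ => //; [lra | move=> *; lra]. Qed.

Ltac vec := apply: functional_extensionality => ?;
  rewrite /vadd /vsub /vscal /vzero; ring.

Lemma dotC n (x y : vec n) : dot x y = dot y x.
Proof. by apply: eq_bigr => i _; ring. Qed.

Lemma dotDl n (x y z : vec n) : dot (vadd x y) z = dot x z + dot y z.
Proof. by rewrite -rsumD; apply: eq_bigr => i _; rewrite /vadd; ring. Qed.

Lemma dotZl n a (x y : vec n) : dot (vscal a x) y = a * dot x y.
Proof. by rewrite -rsumZ; apply: eq_bigr => i _; rewrite /vscal; ring. Qed.

Lemma vsubE n (x y : vec n) : vsub x y = vadd x (vscal (-1) y).
Proof. by vec. Qed.

Lemma dotBl n (x y z : vec n) : dot (vsub x y) z = dot x z - dot y z.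
Proof. by rewrite vsubE dotDl dotZl; ring. Qed.

Lemma dotDr n (x y z : vec n) : dot x (vadd y z) = dot x y + dot x z.
Proof. by rewrite dotC dotDl !(dotC x). Qed.

Lemma dotBr n (x y z : vec n) : dot x (vsub y z) = dot x y - dot x z.
Proof. by rewrite dotC dotBl !(dotC x). Qed.

Lemma dotZr n a (x y : vec n) : dot x (vscal a y) = a * dot x y.
Proof. by rewrite dotC dotZl (dotC x). Qed.

Lemma dot_ge0 n (x : vec n) : 0 <= dot x x.
Proof. by apply: rsum_ge0 => i; nra. Qed.

Lemma norm_ge0 n (x : vec n) : 0 <= norm x.
Proof. exact: sqrt_pos. Qed.

Lemma norm_sq n (x : vec n) : norm x * norm x = dot x x.
Proof. exact/sqrt_sqrt/dot_ge0. Qed.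

Lemma norm_le n (x : vec n) c : 0 <= c -> dot x x <= c * c -> norm x <= c.
Proof. by move=> c0 h; rewrite -(sqrt_square c) //; apply: sqrt_le_1_alt. Qed.

Lemma coord_le_norm n (x : vec n) i : Rabs (x i) <= norm x.
Proof.
rewrite -sqrt_Rsqr_abs; apply: sqrt_le_1_alt; rewrite /dot (bigD1 i) //= /Rsqr.
rewrite -[X in X <= _]Rplus_0_r; apply: Rplus_le_compat_l.
by elim/big_ind: _ => [|a b|j _]; [lra | lra | nra].
Qed.

Lemma norm_le_coord n (x : vec n) e :
  0 <= e -> (forall i, Rabs (x i) <= e) -> norm x <= (INR n + 1) * e.
Proof.
move=> e0 h; have n0 := pos_INR n; apply: norm_le; first by nra.
apply: (Rle_trans _ (\rsum_(i < n) (e * e))).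
  by apply: rsum_le => i; move: (h i); rewrite /Rabs; case: Rcase_abs => *; nra.
have -> : \rsum_(i < n) (e * e) = INR n * (e * e).
  rewrite big_const card_ord; elim: (n) => [|m IH]; first by rewrite /=; ring.
  by rewrite iterS IH S_INR; ring.
by nra.
Qed.

Lemma norm_eq0 n (x : vec n) : norm x <= 0 -> x = @vzero n.
Proof.
move=> h; apply: functional_extensionality => i; rewrite /vzero.
by move: (coord_le_norm x i); rewrite /Rabs; case: Rcase_abs => *; lra.
Qed.

Lemma norm0 n : norm (@vzero n) = 0.
Proof.
rewrite /norm /dot big1 ?sqrt_0 // => i _; rewrite /vzero; ring.
Qed.

Lemma vsub_eq n (x y : vec n) : norm (vsub x y) <= 0 -> x = y.
Proof.
move=> /norm_eq0 h; apply: functional_extensionality => i.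
by move: (f_equal (fun f => f i) h); rewrite /vsub /vzero; lra.
Qed.

(** Nonnegativity of the squared distance from [vscal (norm y) x] to its projection on the line of
    [y]. The form is one-sided; absolute values come from applying it to the opposite vector too. *)
Lemma cauchy_schwarz n (x y : vec n) : dot x y <= norm x * norm y.
Proof.
have [y0|y0] : norm y <= 0 \/ 0 < norm y by lra.
  move/norm_eq0: y0 => ->; rewrite norm0 /dot big1; first by lra.
  by move=> i _; rewrite /vzero; ring.
have := dot_ge0 (vsub (vscal (norm y) x) (vscal (dot x y / norm y) y)).
rewrite !(dotBl, dotBr, dotZl, dotZr) (dotC y x) -!norm_sq => h.
have [?|d0] : dot x y <= 0 \/ 0 < dot x y by lra.
  by have := norm_ge0 x; nra.
have {}h : dot x y * dot x y <= (norm x * norm y) * (norm x * norm y).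
  move: h; set d := dot x y; set a := norm x; set b := norm y => h.
  have e : d / b * b = d by field; rewrite -/b in y0; lra.
  by move: h e; set q := d / b => h e; nra.
by apply: Rsqr_incr_0_var; [exact: h | apply: Rmult_le_pos; apply: norm_ge0].
Qed.

Lemma norm_tri n (x y : vec n) : norm (vadd x y) <= norm x + norm y.
Proof.
have ? := norm_ge0 x; have ? := norm_ge0 y; apply: norm_le; first by lra.
rewrite !(dotDl, dotDr) (dotC y x) -!norm_sq.
by have := cauchy_schwarz x y; nra.
Qed.

Lemma normZ n a (x : vec n) : norm (vscal a x) = Rabs a * norm x.
Proof.
rewrite /norm dotZl dotZr -Rmult_assoc -/(Rsqr a) sqrt_mult ?sqrt_Rsqr_abs //.
- exact: Rle_0_sqr.
- exact: dot_ge0.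
Qed.

Lemma normZ_ge0 n a (x : vec n) : 0 <= a -> norm (vscal a x) = a * norm x.
Proof. by move=> a0; rewrite normZ Rabs_right //; lra. Qed.

Lemma norm_subC n (x y : vec n) : norm (vsub x y) = norm (vsub y x).
Proof.
have -> : vsub x y = vscal (-1) (vsub y x) by vec.
by rewrite normZ Rabs_Ropp Rabs_R1 Rmult_1_l.
Qed.

Lemma norm_sub_tri n (y x z : vec n) :
  norm (vsub x z) <= norm (vsub x y) + norm (vsub y z).
Proof. have -> : vsub x z = vadd (vsub x y) (vsub y z) by vec.
exact: norm_tri. Qed.

Lemma norm_le_sub n (x y : vec n) : norm x <= norm y + norm (vsub x y).
Proof. have {1}-> : x = vadd y (vsub x y) by vec.
exact: norm_tri. Qed.

(** * Matrices and block vectors *)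

Lemma mvD m n (A : mat m n) u v : mv A (vadd u v) = vadd (mv A u) (mv A v).
Proof.
apply: functional_extensionality => i; rewrite /mv /vadd -rsumD.
by apply: eq_bigr => j _; ring.
Qed.

Lemma mvZ m n (A : mat m n) a u : mv A (vscal a u) = vscal a (mv A u).
Proof.
apply: functional_extensionality => i; rewrite /mv /vscal -rsumZ.
by apply: eq_bigr => j _; ring.
Qed.

Lemma mvB m n (A : mat m n) u v : mv A (vsub u v) = vsub (mv A u) (mv A v).
Proof. by rewrite !vsubE mvD mvZ. Qed.

Lemma msub_mv m n (A B : mat m n) u : mv (msub A B) u = vsub (mv A u) (mv B u).
Proof.
rewrite vsubE; apply: functional_extensionality => i.
rewrite /mv /vadd /vscal -rsumZ -rsumD; apply: eq_bigr => j _.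
by rewrite /msub; ring.
Qed.

Lemma mnorm_ge0 m n (A : mat m n) : 0 <= mnorm A.
Proof. exact: sqrt_pos. Qed.

Lemma mv_bound m n (A : mat m n) u : norm (mv A u) <= mnorm A * norm u.
Proof.
apply: norm_le; first by apply: Rmult_le_pos; [apply: mnorm_ge0 | apply: norm_ge0].
have -> : mnorm A * norm u * (mnorm A * norm u)
    = (mnorm A * mnorm A) * (norm u * norm u) by ring.
rewrite /mnorm sqrt_sqrt; last by do 2 apply: rsum_ge0 => ?; nra.
rewrite Rmult_comm -rsumZ; apply: rsum_le => i.
rewrite Rmult_comm -/(dot (A i) (A i)) -norm_sq.
have := cauchy_schwarz (A i) u.
have := cauchy_schwarz (vscal (-1) (A i)) u.
rewrite normZ dotZl Rabs_Ropp Rabs_R1 /dot /mv.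
by have := norm_ge0 (A i); have := norm_ge0 u; nra.
Qed.

Lemma mtvB m n (A : mat m n) x y : mtv A (vsub x y) = vsub (mtv A x) (mtv A y).
Proof. exact: (mvB (fun j i => A i j)). Qed.

Lemma mtv_bound m n (A : mat m n) : exists c, 0 <= c /\ forall x, norm (mtv A x) <= c * norm x.
Proof.
exists (mnorm (fun j i => A i j)); split; first exact: mnorm_ge0.
exact: (mv_bound (fun j i => A i j)).
Qed.

Lemma dot_mv m n (A : mat m n) x u : dot x (mv A u) = dot (mtv A x) u.
Proof.
have -> : dot x (mv A u) = \rsum_(i < m) \rsum_(j < n) (x i * A i j * u j).
  apply: eq_bigr => i _; rewrite /mv -rsumZ; apply: eq_bigr => j _; ring.
rewrite exchange_big; apply: eq_bigr => j _; rewrite /mtv Rmult_comm -rsumZ.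
by apply: eq_bigr => i _; ring.
Qed.

Definition vjoin l1 l2 (a : vec l1) (b : vec l2) : vec (l1 + l2) :=
  fun i => match fintype.split i with inl j => a j | inr j => b j end.

Lemma blk1_join l1 l2 (a : vec l1) (b : vec l2) : blk1 (vjoin a b) = a.
Proof.
apply: functional_extensionality => i; rewrite /blk1 /vjoin.
by rewrite (unsplitK (inl i)).
Qed.

Lemma blk2_join l1 l2 (a : vec l1) (b : vec l2) : blk2 (vjoin a b) = b.
Proof.
apply: functional_extensionality => i; rewrite /blk2 /vjoin.
by rewrite (unsplitK (inr i)).
Qed.

Lemma dot_blk l1 l2 (x y : vec (l1 + l2)) :
  dot x y = dot (blk1 x) (blk1 y) + dot (blk2 x) (blk2 y).
Proof. exact: big_split_ord. Qed.

Lemma norm_blk1 l1 l2 (x : vec (l1 + l2)) : norm (blk1 x) <= norm x.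
Proof.
apply: norm_le (norm_ge0 _) _; rewrite norm_sq dot_blk.
by have := dot_ge0 (blk2 x); lra.
Qed.

Lemma norm_blk2 l1 l2 (x : vec (l1 + l2)) : norm (blk2 x) <= norm x.
Proof.
apply: norm_le (norm_ge0 _) _; rewrite norm_sq dot_blk.
by have := dot_ge0 (blk1 x); lra.
Qed.

Lemma norm_blk l1 l2 (x : vec (l1 + l2)) : norm x <= norm (blk1 x) + norm (blk2 x).
Proof.
have ? := norm_ge0 (blk1 x); have ? := norm_ge0 (blk2 x).
by apply: norm_le; [lra | rewrite dot_blk -!norm_sq; nra].
Qed.

Lemma vconv_blk1 l1 l2 (s : nat -> vec (l1 + l2)) v :
  vconv s v -> vconv (fun k => blk1 (s k)) (blk1 v).
Proof.
move=> h e /h [N hN]; exists N => k /hN.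
by apply: Rle_lt_trans; exact: (norm_blk1 (vsub (s k) v)).
Qed.

Lemma vconv_blk2 l1 l2 (s : nat -> vec (l1 + l2)) v :
  vconv s v -> vconv (fun k => blk2 (s k)) (blk2 v).
Proof.
move=> h e /h [N hN]; exists N => k /hN.
by apply: Rle_lt_trans; exact: (norm_blk2 (vsub (s k) v)).
Qed.

(** * Cluster points and minimizers *)

(** The tolerance of the image derivative, so that membership in [W k] gives the closeness
    conditions there verbatim; [eta 0] is 1. *)
Definition eta (k : nat) : R := / INR (k + 1).

Lemma eta_gt0 k : 0 < eta k.
Proof. by apply: Rinv_0_lt_compat; apply: lt_0_INR; rewrite addn1; apply/ltP. Qed.

Lemma eta_le1 k : eta k <= 1.
Proof.
rewrite /eta -[X in _ <= X]Rinv_1; apply: Rinv_le_contravar; first lra.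
by rewrite addn1 S_INR; have := pos_INR k; lra.
Qed.

Lemma eta_decr j k : (j <= k)%nat -> eta k <= eta j.
Proof.
move=> jk; apply: Rinv_le_contravar.
  by apply: lt_0_INR; rewrite addn1; apply/ltP.
by apply: le_INR; apply/leP; rewrite leq_add2r.
Qed.

Lemma eta_small e : 0 < e -> exists N, forall k, (N <= k)%nat -> eta k < e.
Proof.
move=> /archimed_cor1 [N [hN /ltP N0]]; exists N => k Nk; apply: Rle_lt_trans hN.
apply: Rinv_le_contravar; first exact/lt_0_INR/ltP.
by apply: le_INR; apply/leP; rewrite addn1 ltnW.
Qed.

(* A family [Q k], decreasing in [k] and nowhere empty, is a filter base on the
   data type [T]; replacing [Q] by a finer family plays the role of passing to
   a subsequence. *)
Definition antitone T (Q : nat -> T -> Prop) :=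
  forall j k d, (j <= k)%nat -> Q k d -> Q j d.
Definition nonvoid T (Q : nat -> T -> Prop) := forall k, exists d, Q k d.

(** The cluster value is the limit superior along the family: the supremum of the levels that [f]
    reaches in every [Q k]. *)
Lemma cluster_real T (Q : nat -> T -> Prop) (f : T -> R) M :
  antitone Q -> nonvoid Q -> (forall d, Q 0%nat d -> Rabs (f d) <= M) ->
  exists l, forall e k, 0 < e -> exists d, Q k d /\ Rabs (f d - l) < e.
Proof.
move=> dec prop bnd; pose S r := forall k, exists d, Q k d /\ r <= f d.
have bnd' k d : Q k d -> - M <= f d <= M.
  by move=> /(dec _ _ _ (leq0n k)) /bnd; rewrite /Rabs; case: Rcase_abs => *; lra.
have [|| l [ub lub]] := completeness S.
- by exists M => r /(_ 0%nat) [d [/bnd' ? ?]]; lra.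
- by exists (- M) => k; have [d hd] := prop k; exists d; split=> //; have := bnd' _ _ hd; lra.
exists l => e k e0.
have [r [rS rl]] : exists r, S r /\ l - e < r.
  apply: NNPP => no; suff : l <= l - e by lra.
  by apply: lub => r rS; apply: Rnot_lt_le => ?; apply: no; exists r.
have [k1 hk1] : exists k1, forall d, Q k1 d -> f d < l + e / 2.
  apply: NNPP => no; suff : l + e / 2 <= l by lra.
  apply: ub => k1; apply: NNPP => no'; apply: no; exists k1 => d hd.
  by apply: Rnot_le_lt => ?; apply: no'; exists d.
have [d [hd rd]] := rS (maxn k k1); exists d.
have := hk1 d (dec _ _ _ (leq_maxr _ _) hd).
split; first exact: dec (leq_maxl _ _) hd.
by rewrite /Rabs; case: Rcase_abs => *; lra.
Qed.

(** Bolzano-Weierstrass by induction on coordinates: the family is cut down to data whose first [m]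
    coordinates are within [eta k] of their limits, and the scalar case handles the next one. *)
Lemma cluster_vec T (Q : nat -> T -> Prop) n (f : T -> vec n) M :
  antitone Q -> nonvoid Q -> (forall d, Q 0%nat d -> norm (f d) <= M) ->
  exists l, forall e k, 0 < e -> exists d, Q k d /\ norm (vsub (f d) l) < e.
Proof.
move=> dec prop bnd.
have coords (m : nat) : exists l : vec n, forall e k, 0 < e -> exists d, Q k d /\
    forall i : 'I_n, (i < m)%nat -> Rabs (f d i - l i) < e.
  elim: m => [|m [l hl]].
    by exists (@vzero n) => e k _; have [d] := prop k; exists d.
  have [mn|mn] := ltnP m n; last first.
    exists l => e k /(hl e k) [d [hd h]]; exists d; split => // i _.
    by apply: h; apply: leq_trans mn.
  pose Q' k d := Q k d /\ forall i : 'I_n, (i < m)%nat -> Rabs (f d i - l i) < eta k.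
  have [|k|d [/bnd hd _]|r hr] := @cluster_real _ Q' (fun d => f d (Ordinal mn)) M.
  - move=> j k d jk [hd h]; split; first exact: dec hd.
    by move=> i /h hi; apply: Rlt_le_trans hi (eta_decr jk).
  - exact: hl (eta_gt0 k).
  - exact: Rle_trans (coord_le_norm _ _) hd.
  exists (fun i => if i == Ordinal mn then r else l i) => e k e0.
  have [N hN] := eta_small e0; have [d [[hd h] hdr]] := hr e (maxn k N) e0.
  exists d; split; first exact: dec (leq_maxl _ _) hd.
  move=> i; rewrite ltnS leq_eqVlt => im; case: eqP => [-> //|ne].
  have {}im : (i < m)%nat by case/orP: im => // /eqP im; case: ne; apply: val_inj.
  by apply: Rlt_trans (h i im) (hN _ (leq_maxr _ _)).
have [l hl] := coords n; exists l => e k e0; have n0 := pos_INR n.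
have e'0 : 0 < e / (INR n + 2) by apply: Rdiv_lt_0_compat; lra.
have [d [hd h]] := hl _ k e'0; exists d; split => //.
apply: Rle_lt_trans (norm_le_coord (Rlt_le _ _ e'0) _) _.
  by move=> i; apply: Rlt_le; apply: h.
rewrite -[X in _ < X](_ : (INR n + 2) * (e / (INR n + 2)) = e); last by field; lra.
by nra.
Qed.

(** Convergence at rate [eta k] is built into the index, so several quantities can be made to
    converge in turn, and choosing one datum per index gives a convergent sequence. *)
Lemma refine T (Q : nat -> T -> Prop) n (f : T -> vec n) M :
  antitone Q -> nonvoid Q -> (forall d, Q 0%nat d -> norm (f d) <= M) ->
  exists l, let Q' k d := Q k d /\ norm (vsub (f d) l) < eta k in
    antitone Q' /\ nonvoid Q'.
Proof.
move=> dec prop bnd; have [l hl] := cluster_vec dec prop bnd.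
exists l; split => [j k d jk [hd h]|k]; last exact: hl (eta_gt0 k).
by split; [exact: dec hd | apply: Rlt_le_trans h (eta_decr jk)].
Qed.

Definition lip_on n (S : vec n -> Prop) (f : vec n -> R) :=
  exists L, forall x y, S x -> S y -> f x - f y <= L * norm (vsub x y).

Lemma lip_add n (S : vec n -> Prop) f g :
  lip_on S f -> lip_on S g -> lip_on S (fun x => f x + g x).
Proof.
move=> [L hL] [M hM]; exists (L + M) => x y xS yS.
by have := hL x y xS yS; have := hM x y xS yS; lra.
Qed.

Lemma lip_scale n (S : vec n -> Prop) f c :
  0 <= c -> lip_on S f -> lip_on S (fun x => c * f x).
Proof.
move=> c0 [L hL]; exists (c * L) => x y xS yS.
by have := hL x y xS yS; nra.
Qed.

Lemma lip_sqr n (S : vec n -> Prop) f B : (forall x, S x -> 0 <= f x <= B) ->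
  lip_on S f -> lip_on S (fun x => f x * f x).
Proof.
move=> hB [L hL]; exists (2 * B * L) => x y xS yS.
have := hB x xS; have := hB y yS; have := hL x y xS yS.
have := hL y x yS xS; rewrite (norm_subC y).
move: (L * _) (Rmult_assoc (2 * B) L (norm (vsub x y))) => q -> *.
have [?|?] : f y <= f x \/ f x <= f y by lra.
  have : (f x - f y) * (f x + f y) <= q * (2 * B) by apply: Rmult_le_compat; lra.
  by lra.
have : 0 <= (f y - f x) * (f x + f y) by apply: Rmult_le_pos; lra.
have : 0 <= B * q by apply: Rmult_le_pos; lra.
by lra.
Qed.

Lemma lip_dist n (S : vec n -> Prop) c : lip_on S (fun x => norm (vsub x c)).
Proof. by exists 1 => x y _ _; have := norm_sub_tri y x c; lra. Qed.

(** The near-minimal sublevel sets form a decreasing family; a cluster point lies in [S] by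
    closedness and attains the infimum, which is [- m], by the Lipschitz bound. *)
Lemma min_exists n (S : vec n -> Prop) (f : vec n -> R) M :
  is_closed S -> (exists x, S x) -> (forall x, S x -> norm x <= M) ->
  (forall x, S x -> 0 <= f x) -> lip_on S f ->
  exists x, S x /\ forall y, S y -> f x <= f y.
Proof.
move=> cl [x0 x0S] bnd pos [L hL].
have [|| m [ub lub]] := completeness (fun r => exists x, S x /\ r = - f x).
- by exists 0 => r [x [/pos ? ->]]; lra.
- by exists (- f x0), x0.
pose Q k x := S x /\ f x < - m + eta k.
have decQ : antitone Q.
  by move=> j k d /eta_decr ? [? ?]; split=> //; lra.
have propQ : nonvoid Q.
  move=> k; apply: NNPP => no; suff : m <= m - eta k by have := eta_gt0 k; lra.
  apply: lub => r [x [xS ->]]; apply: Rnot_lt_le => ?; apply: no; exists x.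
  by split => //; lra.
have [x hx] := cluster_vec (f := fun x : vec n => x) decQ propQ (fun d h => bnd d (proj1 h)).
have xS : S x.
  by apply: cl => e e0; have [w [[wS _] ?]] := hx e 0%nat e0; exists w.
exists x; split=> // y yS; apply: (Rle_trans _ (- m)); last first.
  by have := ub (- f y); rewrite /is_upper_bound => h; have := h (ex_intro _ y (conj yS erefl)); lra.
apply: Rnot_lt_le => lt.
have e0 : 0 < (f x + m) / 2 by lra.
have [N hN] := eta_small e0.
have L0 : 0 < Rabs L + 1 by have := Rabs_pos L; lra.
have e1 : 0 < (f x + m) / 2 / (Rabs L + 1) by apply: Rdiv_lt_0_compat.
have [w [[wS hw] hxw]] := hx _ N e1; have := hN N (leqnn N).
have := hL x w xS wS; rewrite norm_subC => h1 h2.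
have : L * norm (vsub w x) <= (Rabs L + 1) * norm (vsub w x).
  by apply: Rmult_le_compat_r (norm_ge0 _) _; have := Rle_abs L; lra.
have : (Rabs L + 1) * norm (vsub w x) <= (f x + m) / 2.
  rewrite -[X in _ <= X](_ : (Rabs L + 1) * ((f x + m) / 2 / (Rabs L + 1)) = _); last by field; lra.
  by apply: Rmult_le_compat_l; lra.
by lra.
Qed.

(** * Distances, projections and normals *)

Lemma closed_ball n (c : vec n) r : is_closed (fun x => norm (vsub x c) <= r).
Proof.
move=> v h; apply: Rnot_lt_le => lt.
have [|w [hw ?]] := h (norm (vsub v c) - r); first lra.
by have := norm_sub_tri w v c; rewrite (norm_subC v w); lra.
Qed.

Lemma closed_inter n (S S' : vec n -> Prop) :
  is_closed S -> is_closed S' -> is_closed (fun x => S x /\ S' x).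
Proof.
move=> cS cS' v h; split; [apply: cS | apply: cS'] => e /h [w [[? ?] ?]];
by exists w.
Qed.

Lemma ball_bound n (c : vec n) r x : norm (vsub x c) <= r -> norm x <= norm c + r.
Proof. by have := norm_le_sub x c; lra. Qed.

Lemma setdist_spec n (w : vec n) C : (exists y, C y) -> is_dist w C (setdist w C).
Proof.
move=> [y0 y0C]; apply: epsilon_spec.
have [|| m [ub lub]] := completeness (fun r => exists y, C y /\ r = - norm (vsub w y)).
- by exists 0 => r [x [_ ->]]; have := norm_ge0 (vsub w x); lra.
- by exists (- norm (vsub w y0)), y0.
exists (- m); split => [s sC|e he].
  by have := ub (- norm (vsub w s)) (ex_intro _ s (conj sC erefl)); lra.
suff : m <= - e by lra.
by apply: lub => r [y [/he ? ->]]; lra.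
Qed.

Lemma setdist_le n (w : vec n) (C : vec n -> Prop) y :
  C y -> setdist w C <= norm (vsub w y).
Proof. by move=> yC; have [h _] := setdist_spec w (ex_intro _ y yC); apply: h. Qed.

Lemma setdist_ge n (w : vec n) (C : vec n -> Prop) e : (exists y, C y) ->
  (forall y, C y -> e <= norm (vsub w y)) -> e <= setdist w C.
Proof. by move=> /(setdist_spec w) [_]; apply. Qed.

Lemma setdist_ge0 n (w : vec n) (C : vec n -> Prop) : (exists y, C y) -> 0 <= setdist w C.
Proof. by move=> /setdist_ge; apply => y _; apply: norm_ge0. Qed.

Lemma setdist_near n (w : vec n) (C : vec n -> Prop) e :
  (exists y, C y) -> setdist w C < e -> exists y, C y /\ norm (vsub w y) < e.
Proof.
move=> ne lt; apply: NNPP => no; suff : e <= setdist w C by lra.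
by apply: setdist_ge => // y yC; apply: Rnot_lt_le => ?; apply: no; exists y.
Qed.

Lemma setdist_lip n (w w' : vec n) (C : vec n -> Prop) : (exists y, C y) ->
  setdist w C - setdist w' C <= norm (vsub w w').
Proof.
move=> ne; suff : setdist w C - norm (vsub w w') <= setdist w' C by lra.
apply: setdist_ge => // y yC; have := setdist_le w yC.
by have := norm_sub_tri w' w y; lra.
Qed.

Lemma setdist_proj n (w : vec n) (C : vec n -> Prop) : is_closed C -> (exists y, C y) ->
  exists y, C y /\ setdist w C = norm (vsub w y).
Proof.
move=> cl [y0 y0C].
pose S y := C y /\ norm (vsub y w) <= norm (vsub y0 w).
have [||y [_ hy]|y _||y [[yC hy] min]] :=
    @min_exists n S (fun y => norm (vsub y w)) (norm w + norm (vsub y0 w)).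
- exact: closed_inter cl (@closed_ball _ _ _).
- by exists y0; split=> //; lra.
- exact: ball_bound hy.
- exact: norm_ge0.
- exact: lip_dist.
exists y; split=> //; apply: Rle_antisym; first exact: setdist_le.
apply: setdist_ge; first by exists y0.
move=> z zC; rewrite !(norm_subC w).
have [?|?] : norm (vsub z w) <= norm (vsub y0 w) \/ norm (vsub y0 w) < norm (vsub z w) by lra.
  exact: min.
by lra.
Qed.

Lemma norm_add_sq n (x y : vec n) :
  norm (vadd x y) * norm (vadd x y) = norm x * norm x + 2 * dot x y + norm y * norm y.
Proof. by rewrite !norm_sq !(dotDl, dotDr) (dotC y x); ring. Qed.

(** Moving from the nearest point within [C] cannot decrease the squared distance to [w]; after
    division by [t k] the first-order gain is at most [t k] times a bounded quantity. *)
Lemma projection_normal n (C : vec n -> Prop) w y a : 0 <= a -> C y ->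
  setdist w C = norm (vsub w y) -> reg_normal C y (vscal a (vsub w y)).
Proof.
move=> a0 yC prj u [t [us [[t0 tto0] [uto hC]]]].
rewrite dotZl; suff : dot (vsub w y) u <= 0 by nra.
apply: Rnot_lt_le; set z := vsub w y => pos.
have key k : 2 * dot z (us k) <= t k * (norm (us k) * norm (us k)).
  have := setdist_le w (hC k); rewrite prj -/z.
  have -> : vsub w (vadd y (vscal (t k) (us k))) = vadd z (vscal (- t k) (us k)).
    by rewrite /z; vec.
  have := norm_add_sq z (vscal (- t k) (us k)); have := norm_ge0 z.
  rewrite dotZr normZ Rabs_Ropp (Rabs_right (t k)); last by have := t0 k; lra.
  have := t0 k; set p := norm (vadd _ _); set q := norm _; set s := norm _.
  move=> tp q0 eq le.
  have : q * q <= p * p by apply: Rmult_le_compat.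
  rewrite eq => h; apply: (Rmult_le_reg_l (t k)) => //; nra.
have z0 : 0 < norm z + 1 by have := norm_ge0 z; lra.
pose B := norm u + 1; have B1 : 1 <= B by have := norm_ge0 u; rewrite /B; lra.
have e1 : 0 < dot z u / (norm z + 1) / 2 by apply: Rdiv_lt_0_compat; [apply: Rdiv_lt_0_compat | lra].
have e2 : 0 < dot z u / (B * B) by apply: Rdiv_lt_0_compat => //; nra.
have [N1 h1] := uto _ e1; have [N2 h2] := tto0 _ e2; have [N3 h3] := uto 1 Rlt_0_1.
pose k := maxn N1 (maxn N2 N3).
have := h1 k (leq_maxl _ _).
have := h2 k (leq_trans (leq_maxl N2 N3) (leq_maxr _ _)).
have := h3 k (leq_trans (leq_maxr N2 N3) (leq_maxr _ _)).
move=> c3 c2 c1; have := key k; have := t0 k.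
have usB : norm (us k) <= B by have := norm_le_sub (us k) u; rewrite /B; lra.
have d1 : dot z u - dot z (us k) <= norm z * norm (vsub (us k) u).
  by rewrite norm_subC -dotBr; apply: cauchy_schwarz.
have d2 : norm z * norm (vsub (us k) u) <= dot z u / 2.
  rewrite -[X in _ <= X](_ : (norm z + 1) * (dot z u / (norm z + 1) / 2) = _); last by field; lra.
  by apply: Rmult_le_compat; [apply: norm_ge0 | apply: norm_ge0 | lra | lra].
have d3 : t k * (norm (us k) * norm (us k)) < dot z u.
  rewrite -[X in _ < X](_ : dot z u / (B * B) * (B * B) = _); last by field; lra.
  apply: (Rle_lt_trans _ (t k * (B * B))); last by apply: Rmult_lt_compat_r => //; nra.
  apply: Rmult_le_compat_l; first by have := t0 k; lra.
  by apply: Rmult_le_compat => //; apply: norm_ge0.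
by lra.
Qed.

(** * Uniform strict differentiability *)

(** Quantitative strict differentiability. The matrix [A] is fixed and both points vary, so one
    estimate can serve all parameters near [pb]. *)
Definition near_linear n l (G : vec n -> vec l) (A : mat l n) xb delta e :=
  forall x x', norm (vsub x xb) < delta -> norm (vsub x' xb) < delta ->
    norm (vsub (vsub (G x) (G x')) (mv A (vsub x x'))) <= e * norm (vsub x x').

Lemma ball_convex n (c x x' : vec n) d s : 0 <= s <= 1 ->
  norm (vsub x c) < d -> norm (vsub x' c) < d ->
  norm (vsub (vadd x' (vscal s (vsub x x'))) c) < d.
Proof.
move=> s01 hx hx'.
have -> : vsub (vadd x' (vscal s (vsub x x'))) c
    = vadd (vscal (1 - s) (vsub x' c)) (vscal s (vsub x c)) by vec.
have := norm_tri (vscal (1 - s) (vsub x' c)) (vscal s (vsub x c)).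
rewrite !normZ_ge0; try lra.
move: (norm (vsub x c)) (norm (vsub x' c)) hx hx' => a b ha hb.
have := Rmult_le_compat_l (1 - s) _ _ ltac:(lra) (Rmax_r a b).
have := Rmult_le_compat_l s _ _ ltac:(lra) (Rmax_l a b).
by have := Rmax_lub_lt _ _ _ ha hb; lra.
Qed.

(** The mean value theorem is scalar, so the remainder [v] is tested against itself along the
    segment: its squared norm is a derivative at an intermediate point, hence at most
    [norm v * (e * norm w)]. *)
Lemma near_linear_deriv n l (G : vec n -> vec l) (DG : vec n -> mat l n) A xb delta e :
  (forall x, norm (vsub x xb) < delta -> forall eps, 0 < eps -> exists d, 0 < d /\
     forall h, norm h < d ->
       norm (vsub (vsub (G (vadd x h)) (G x)) (mv (DG x) h)) <= eps * norm h) ->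
  (forall x, norm (vsub x xb) < delta -> mnorm (msub (DG x) A) <= e) ->
  near_linear G A xb delta e.
Proof.
move=> dG bG x x' hx hx'; set w := vsub x x'; set v := vsub _ (mv A w).
pose X s := vadd x' (vscal s w).
pose th s := dot v (G (X s)) - s * dot v (mv A w).
pose dth s := dot v (mv (DG (X s)) w) - dot v (mv A w).
have inb s : 0 <= s <= 1 -> norm (vsub (X s) xb) < delta by move=> ?; apply: ball_convex.
have v0 := norm_ge0 v; have w0 := norm_ge0 w.
have der s : 0 <= s <= 1 -> derivable_pt_lim th s (dth s).
  move=> s01 eps eps0.
  have B0 : 0 < norm v * norm w + 1 by have := Rmult_le_pos _ _ v0 w0; lra.
  have e'0 : 0 < eps / (norm v * norm w + 1) by apply: Rdiv_lt_0_compat.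
  have [d [d0 hd]] := dG _ (inb s s01) _ e'0.
  have d'0 : 0 < d / (norm w + 1) by apply: Rdiv_lt_0_compat => //; lra.
  exists (mkposreal _ d'0) => h hne /= hlt.
  have hpos : 0 < Rabs h by apply: Rabs_pos_lt.
  have small : norm (vscal h w) < d.
    rewrite normZ; apply: (Rle_lt_trans _ (Rabs h * (norm w + 1))); first by nra.
    rewrite -[X in _ < X](_ : d / (norm w + 1) * (norm w + 1) = d); last by field; lra.
    by apply: Rmult_lt_compat_r => //; lra.
  have := hd _ small; rewrite normZ.
  set rem := vsub _ (mv _ _) => hrem.
  have -> : (th (s + h) - th s) / h - dth s = dot v rem / h.
    have -> : dot v rem = dot v (G (X (s + h))) - dot v (G (X s))
        - h * dot v (mv (DG (X s)) w).
      rewrite /rem mvZ !dotBr dotZr; congr (dot _ (G _) - _ - _).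
      by rewrite /X; vec.
    by rewrite /th /dth; field.
  rewrite /Rdiv Rabs_mult Rabs_inv.
  apply: (Rmult_lt_reg_r (Rabs h)) => //.
  have -> : Rabs (dot v rem) * / Rabs h * Rabs h = Rabs (dot v rem) by field; lra.
  have : Rabs (dot v rem) <= norm v * norm rem.
    have := cauchy_schwarz v rem; have := cauchy_schwarz v (vscal (-1) rem).
    rewrite dotZr normZ Rabs_Ropp Rabs_R1.
    by rewrite /(Rabs (dot _ _)); case: Rcase_abs => *; lra.
  have : norm v * norm rem <= norm v * (eps / (norm v * norm w + 1) * (Rabs h * norm w)).
    exact: Rmult_le_compat_l.
  have -> : norm v * (eps / (norm v * norm w + 1) * (Rabs h * norm w))
      = eps / (norm v * norm w + 1) * (norm v * norm w) * Rabs h by ring.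
  have : eps / (norm v * norm w + 1) * (norm v * norm w) * Rabs h < eps * Rabs h.
    apply: Rmult_lt_compat_r => //.
    rewrite -[X in _ < X](_ : eps / (norm v * norm w + 1) * (norm v * norm w + 1) = eps);
      last by field; lra.
    by apply: Rmult_lt_compat_l; lra.
  by lra.
have [c [eqc [c0 c1]]] := MVT_cor2 _ _ _ _ Rlt_0_1 der.
have X1 : X 1 = x by rewrite /X /w; vec.
have X0 : X 0 = x' by rewrite /X /w; vec.
have vv : norm v * norm v = dth c.
  rewrite norm_sq; move: eqc; rewrite /th X1 X0 => eqc.
  by rewrite {2}/v !dotBr; lra.
have : dth c <= norm v * (e * norm w).
  rewrite /dth -dotBr -msub_mv; apply: (Rle_trans _ _ _ (cauchy_schwarz _ _)).
  apply: Rmult_le_compat_l => //; apply: (Rle_trans _ _ _ (mv_bound _ _)).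
  by apply: Rmult_le_compat_r => //; apply/bG/inb; lra.
rewrite -vv => h; have [?|?] : norm v = 0 \/ 0 < norm v by lra.
  have : 0 <= e by apply: Rle_trans (bG x hx); apply: mnorm_ge0.
  by nra.
by apply: Rmult_le_reg_l h.
Qed.

(** * Neighborhoods of the reference parameter and pointwise forms of Robinson stability *)

Section Neighborhoods.

Variables (P : Type) (T : topology P) (pb : P).

Lemma nbhd_and V W : nbhd_P T V pb -> nbhd_P T W pb -> nbhd_P T (fun p => V p /\ W p) pb.
Proof.
move=> [O [oO [Op OV]]] [O' [oO' [O'p O'W]]]; exists (fun p => O p /\ O' p).
by split; [exact: open_inter | split=> // p [/OV ? /O'W]].
Qed.

Lemma nbhd_sub (V W : P -> Prop) : (forall p, V p -> W p) -> nbhd_P T V pb -> nbhd_P T W pb.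
Proof. by move=> VW [O [oO [Op OV]]]; exists O; split=> //; split=> // p /OV /VW. Qed.

(** Finite intersections suffice to turn a sequence of neighborhoods into a decreasing one. *)
Lemma nbhd_chain (V : nat -> P -> Prop) : (forall k, nbhd_P T (V k) pb) ->
  forall k, nbhd_P T (fun p => forall j, (j <= k)%nat -> V j p) pb.
Proof.
move=> hV; elim=> [|k IH].
  by apply: nbhd_sub (hV 0%nat) => p ? j; rewrite leqn0 => /eqP ->.
apply: nbhd_sub (nbhd_and IH (hV k.+1)) => p [h hk] j.
by rewrite leq_eqVlt => /orP [/eqP -> //|]; rewrite ltnS; apply: h.
Qed.

Lemma standing_near_linear n l (g : P -> vec n -> vec l) Dg xb e :
  standing T g Dg pb xb -> 0 < e ->
  exists V delta, nbhd_P T V pb /\ 0 < delta /\ forall p, V p ->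
    [/\ near_linear (g p) (Dg pb xb) xb delta e,
        norm (vsub (g p xb) (g pb xb)) < e &
        mnorm (msub (Dg p xb) (Dg pb xb)) < e].
Proof.
move=> [[U [V [[d1 [d10 hU]] [nV hV]]]] [cg cDg]] e0.
have [V2 [d2 [nV2 [d20 h2]]]] := cg e e0.
have [V3 [d3 [nV3 [d30 h3]]]] := cDg e e0.
have xbb : norm (vsub xb xb) = 0.
  by rewrite (_ : vsub xb xb = @vzero n) ?norm0 //; vec.
exists (fun p => V p /\ (V2 p /\ V3 p)), (Rmin d1 d3).
split; first by do 2 apply: nbhd_and => //.
split; first exact: Rmin_pos.
move=> p [Vp [V2p V3p]]; split; [|by apply: h2 => //; lra|by apply: h3 => //; lra].
apply: (@near_linear_deriv _ _ _ (Dg p)) => x hx.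
  by apply: (proj1 (hV p Vp)); apply: hU; have := Rmin_l d1 d3; lra.
by apply: Rlt_le; apply: h3 => //; have := Rmin_r d1 d3; lra.
Qed.

(** The distance to the solution set need not be attained; the constant [kap + 1] leaves strict
    slack whenever [h p x] differs from [y], and otherwise [x] itself serves. *)
Lemma robinson_elim n m (h : P -> vec n -> vec m) K xb : (exists y, K y) ->
  robinson_stable T h K pb xb ->
  exists c V delta, 0 < c /\ nbhd_P T V pb /\ 0 < delta /\
    forall p x y, V p -> norm (vsub x xb) < delta -> K y ->
      exists x', K (h p x') /\ norm (vsub x x') <= c * norm (vsub (h p x) y).
Proof.
move=> Kne [kap [U [V [kap0 [[d [d0 hU]] [nV hs]]]]]].
exists (kap + 1), V, d; split; first lra; do 2 (split=> //).
move=> p x y Vp hx Ky; have [Sne hd] := hs p x Vp (hU x hx) Kne.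
have [z|pos] : norm (vsub (h p x) y) <= 0 \/ 0 < norm (vsub (h p x) y) by lra.
  exists x; rewrite (vsub_eq z); split=> //.
  rewrite (_ : vsub x x = @vzero n) ?norm0; last by vec.
  by apply: Rmult_le_pos (norm_ge0 _); lra.
have [|x' [Kx' lt]] := @setdist_near _ x (fun xi => K (h p xi))
    ((kap + 1) * norm (vsub (h p x) y)) Sne.
  apply: (Rle_lt_trans _ _ _ hd).
  by have := Rmult_le_compat_l _ _ _ kap0 (setdist_le (h p x) Ky); lra.
by exists x'; split=> //; lra.
Qed.

(* The extra hypothesis on [y] loses nothing: a point [y] farther from [h p x]
   than [yb] may be replaced by [yb]. *)
Lemma robinson_intro n m (h : P -> vec n -> vec m) (K : vec m -> Prop) xb yb c V delta :
  K yb -> 0 <= c -> nbhd_P T V pb -> 0 < delta ->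
  (forall p x y, V p -> norm (vsub x xb) < delta -> K y ->
     norm (vsub (h p x) y) <= norm (vsub (h p x) yb) ->
     exists x', K (h p x') /\ norm (vsub x x') <= c * norm (vsub (h p x) y)) ->
  robinson_stable T h K pb xb.
Proof.
move=> Kyb c0 nV d0 hs; exists c, (fun x => norm (vsub x xb) < delta), V.
split=> //; split; first by exists delta.
split=> // p x Vp hx Kne.
have {}hs y : K y ->
    exists x', K (h p x') /\ norm (vsub x x') <= c * norm (vsub (h p x) y).
  move=> Ky.
  have [le|lt] : norm (vsub (h p x) y) <= norm (vsub (h p x) yb) \/
      norm (vsub (h p x) yb) < norm (vsub (h p x) y) by lra.
    exact: hs.
  have [x' [? ?]] := hs p x yb Vp hx Kyb (Rle_refl _).
  by exists x'; split=> //; nra.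
have [x0 [Kx0 _]] := hs yb Kyb; split; first by exists x0.
have le y : K y -> setdist x (fun xi => K (h p xi)) <= c * norm (vsub (h p x) y).
  move=> /hs [x' [Kx' ?]]; have := @setdist_le _ x (fun xi => K (h p xi)) x' Kx'; lra.
have [c00|cpos] : c = 0 \/ 0 < c by lra.
  by have := le yb Kyb; rewrite c00 !Rmult_0_l.
rewrite -[X in X <= _](_ : c * (setdist x (fun xi => K (h p xi)) / c) = _); last by field; lra.
apply: Rmult_le_compat_l => //; apply: setdist_ge => // y /le {}le.
apply: (Rmult_le_reg_l c) => //; rewrite [X in X <= _](_ : _ = setdist x (fun xi => K (h p xi))) //.
by field; lra.
Qed.

End Neighborhoods.

(** * Penalization for a fixed parameter *)

Lemma setdist_mem n (w : vec n) (C : vec n -> Prop) : is_closed C -> (exists y, C y) ->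
  setdist w C <= 0 -> C w.
Proof.
move=> cl ne le; have [y [Cy e]] := setdist_proj w cl ne.
by rewrite (_ : w = y) //; apply: vsub_eq; lra.
Qed.

Lemma setdist_eq0 n (w : vec n) (C : vec n -> Prop) : C w -> setdist w C = 0.
Proof.
move=> Cw; apply: Rle_antisym; last by apply: setdist_ge0; exists w.
have := setdist_le w Cw; rewrite (_ : vsub w w = @vzero n) ?norm0 //; by vec.
Qed.

(** From [2 * al * q <= al * al + q * q]. It supplies a quadratic majorant of the norm away from the
    origin whose linear part is the gradient. *)
Lemma norm_add_le n (a w : vec n) : 0 < norm a ->
  norm (vadd a w) <= norm a + dot (vscal (/ norm a) a) w + norm w * norm w / (2 * norm a).
Proof.
move=> a0; have := norm_add_sq a w; have := norm_ge0 (vadd a w); rewrite dotZl.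
set q := norm (vadd a w); set al := norm a; set b := norm w; set d := dot a w.
rewrite -/al in a0 => q0 e; apply: (Rmult_le_reg_l (2 * al)); first lra.
have -> : 2 * al * (al + / al * d + b * b / (2 * al)) = al * al + q * q.
  by rewrite e; field; lra.
by have := Rle_0_sqr (q - al); rewrite /Rsqr; lra.
Qed.

(** A short step against [v] gains [norm v] per unit length, and for small steps the quadratic term
    cannot offset an excess over [c]. *)
Lemma approx_stationary n (v : vec n) c B s : 0 < s -> 0 <= c ->
  (forall h, norm h <= s -> 0 <= dot v h + c * norm h + B * (norm h * norm h)) ->
  norm v <= c.
Proof.
move=> s0 c0 st; apply: Rnot_lt_le => lt; set N := norm v in lt.
have B0 := Rabs_pos B; have BB := Rle_abs B.
pose m := Rmin s ((N - c) / (2 * (Rabs B + 1))).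
have m0 : 0 < m by apply: Rmin_pos => //; apply: Rdiv_lt_0_compat; lra.
have ms : m <= s by apply: Rmin_l.
have mB : m * (Rabs B + 1) <= (N - c) / 2.
  rewrite -[X in _ <= X](_ : (N - c) / (2 * (Rabs B + 1)) * (Rabs B + 1) = _);
    last by field; lra.
  by apply: Rmult_le_compat_r; [lra | apply: Rmin_r].
have mN : m / N * N = m by field; lra.
have nh : norm (vscal (- (m / N)) v) = m.
  rewrite normZ Rabs_Ropp Rabs_right //.
  by apply: Rle_ge; apply: Rlt_le; apply: Rdiv_lt_0_compat; lra.
have := st (vscal (- (m / N)) v); rewrite nh dotZr -norm_sq -/N => /(_ ms).
have -> : - (m / N) * (N * N) = - m * N by rewrite -[in RHS]mN; ring.
have : m * (B * m) <= m * ((N - c) / 2) by apply: Rmult_le_compat_l; nra.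
by nra.
Qed.

Section Penalization.

Variables (n l1 l2 : nat) (G : vec n -> vec (l1 + l2)).
Variables (C1 : vec l1 -> Prop) (C2 : vec l2 -> Prop) (xb : vec n) (R0 L K : R).
Hypotheses (cl1 : is_closed C1) (cl2 : is_closed C2).
Hypotheses (ne1 : exists y, C1 y) (ne2 : exists y, C2 y).
Hypotheses (L0 : 0 <= L) (K0 : 0 < K).
Hypothesis lipG : forall x x', norm (vsub x xb) < R0 -> norm (vsub x' xb) < R0 ->
  norm (vsub (G x) (G x')) <= L * norm (vsub x x').
Hypothesis reg2 : forall x y, norm (vsub x xb) < R0 -> C2 y ->
  exists x', C2 (blk2 (G x')) /\ norm (vsub x x') <= K * norm (vsub (blk2 (G x)) y).

Let phi x := setdist (blk1 (G x)) C1.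
Let psi x := setdist (blk2 (G x)) C2.

Lemma blk1_lip x x' : norm (vsub x xb) < R0 -> norm (vsub x' xb) < R0 ->
  norm (vsub (blk1 (G x)) (blk1 (G x'))) <= L * norm (vsub x x').
Proof. by move=> ? ?; apply: Rle_trans (norm_blk1 (vsub (G x) (G x'))) (lipG _ _). Qed.

Lemma blk2_lip x x' : norm (vsub x xb) < R0 -> norm (vsub x' xb) < R0 ->
  norm (vsub (blk2 (G x)) (blk2 (G x'))) <= L * norm (vsub x x').
Proof. by move=> ? ?; apply: Rle_trans (norm_blk2 (vsub (G x) (G x'))) (lipG _ _). Qed.

Lemma phi_lip x x' : norm (vsub x xb) < R0 -> norm (vsub x' xb) < R0 ->
  phi x - phi x' <= L * norm (vsub x x').
Proof. by move=> hx hx'; apply: Rle_trans (setdist_lip _ _ ne1) (blk1_lip hx hx'). Qed.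

Lemma psi_lip x x' : norm (vsub x xb) < R0 -> norm (vsub x' xb) < R0 ->
  psi x - psi x' <= L * norm (vsub x x').
Proof. by move=> hx hx'; apply: Rle_trans (setdist_lip _ _ ne2) (blk2_lip hx hx'). Qed.

Lemma feasible2_closed r : r < R0 ->
  is_closed (fun x => norm (vsub x xb) <= r /\ C2 (blk2 (G x))).
Proof.
move=> rR v hv; have bv : norm (vsub v xb) <= r.
  by apply: (@closed_ball n xb r) => e /hv [w [[? _] ?]]; exists w.
split=> //; apply: cl2 => e e0.
have e'0 : 0 < e / (L + 1) by apply: Rdiv_lt_0_compat; lra.
have [w [[bw Cw] wv]] := hv _ e'0; exists (blk2 (G w)); split=> //.
apply: (Rle_lt_trans _ (L * norm (vsub w v))); first by apply: blk2_lip; lra.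
rewrite -[X in _ < X](_ : (L + 1) * (e / (L + 1)) = e); last by field; lra.
by have := norm_ge0 (vsub w v); nra.
Qed.

(* Ekeland's principle, with the minimum attained by compactness. *)
Lemma penalized_minimizer r rho e x0 y0 :
  r < R0 -> rho <= r -> 0 < e -> C1 (blk1 y0) -> C2 (blk2 y0) ->
  let kap := K + (1 + L * K) / e in
  norm (vsub x0 xb) + kap * norm (vsub (G x0) y0) < rho ->
  (forall x, C1 (blk1 (G x)) -> C2 (blk2 (G x)) ->
     kap * norm (vsub (G x0) y0) < norm (vsub x0 x)) ->
  exists x, [/\ norm (vsub x xb) < rho, C2 (blk2 (G x)), 0 < phi x &
    forall z, norm (vsub z xb) <= r -> C2 (blk2 (G z)) ->
      phi x <= phi z + e * norm (vsub x z)].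
Proof.
move=> rR rhor e0 C1y C2y kap; set d := norm (vsub (G x0) y0) => near far.
have d0 : 0 <= d by apply: norm_ge0.
have LK0 : 0 <= L * K by apply: Rmult_le_pos; lra.
have q0 : 0 <= (1 + L * K) / e by apply: Rmult_le_pos; [lra | apply/Rlt_le/Rinv_0_lt_compat].
have kapK : K * d <= kap * d by apply: Rmult_le_compat_r; rewrite /kap; lra.
have Kd : 0 <= K * d by apply: Rmult_le_pos; lra.
have hx0 : norm (vsub x0 xb) < R0 by lra.
(* Restoring the second constraint costs [K * d]: the first summand of [kap]. *)
have [x1 [C2x1 hx1]] := reg2 hx0 C2y.
have {}hx1 : norm (vsub x0 x1) <= K * d.
  apply: Rle_trans hx1 _; apply: Rmult_le_compat_l; first lra.
  exact: (norm_blk2 (vsub (G x0) y0)).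
have bx1 : norm (vsub x1 xb) < rho.
  by have := norm_sub_tri x0 x1 xb; rewrite (norm_subC x1 x0); lra.
have phi1 : phi x1 <= (1 + L * K) * d.
  have := phi_lip (x := x1) (x' := x0) ltac:(lra) hx0; rewrite norm_subC.
  have : phi x0 <= d.
    apply: Rle_trans (setdist_le _ C1y) _; exact: (norm_blk1 (vsub (G x0) y0)).
  by have := Rmult_le_compat_l _ _ _ L0 hx1; lra.
pose S x := norm (vsub x xb) <= r /\ C2 (blk2 (G x)).
have [|||||x [[bx C2x] min]] := @min_exists n S (fun x => phi x + e * norm (vsub x x1)) (norm xb + r).
- exact: feasible2_closed.
- by exists x1; split=> //; lra.
- by move=> x [/ball_bound].
- move=> x _; apply: Rplus_le_le_0_compat; first exact: setdist_ge0.
  by apply: Rmult_le_pos (norm_ge0 _); lra.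
- apply: lip_add; last by apply: lip_scale; [lra | apply: lip_dist].
  by exists L => x y [? _] [? _]; apply: phi_lip; lra.
have x11 : norm (vsub x1 x1) = 0 by rewrite (_ : vsub x1 x1 = @vzero n) ?norm0 //; vec.
(* Comparison with [x1] bounds the drift of the minimizer: the second summand of [kap]. Hence [x]
   stays in the region around [x0] that contains no feasible point. *)
have dx1 : norm (vsub x x1) <= (1 + L * K) / e * d.
  have := min x1 (conj (Rlt_le _ _ (Rlt_le_trans _ _ _ bx1 rhor)) C2x1).
  rewrite x11; have := setdist_ge0 (blk1 (G x)) ne1; rewrite -/(phi x) => ? ?.
  apply: (Rmult_le_reg_l e) => //.
  by rewrite (_ : e * ((1 + L * K) / e * d) = (1 + L * K) * d); [lra | field; lra].
have x0x : norm (vsub x0 x) <= kap * d.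
  by have := norm_sub_tri x1 x0 x; rewrite (norm_subC x1 x) /kap; lra.
exists x; split=> //.
- by have := norm_sub_tri x0 x xb; rewrite (norm_subC x x0); lra.
- apply: Rnot_le_lt => le; have C1x := setdist_mem cl1 ne1 le.
  by have := far x C1x C2x; lra.
- move=> z bz C2z; have := min z (conj bz C2z).
  have := norm_sub_tri x z x1; rewrite (norm_subC z x) => ? ?.
  by have := Rmult_le_compat_l e (norm (vsub z x1)) _ ltac:(lra) ltac:(eassumption); lra.
Qed.

(* The constraint [blk2 (G x) \in C2] is replaced by a large multiple [j] of the
   squared distance; regularity of the second block bounds the multiplier
   [2 j (blk2 (G xh) - z)] independently of [j]. *)
Lemma approximate_multiplier r x e A delta eta0 rho :
  r < R0 -> norm (vsub x xb) < r -> 0 < e <= 1 -> C2 (blk2 (G x)) -> 0 < phi x ->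
  (forall z, norm (vsub z xb) <= r -> C2 (blk2 (G z)) ->
     phi x <= phi z + e * norm (vsub x z)) ->
  near_linear G A xb delta eta0 -> 0 <= eta0 -> norm (vsub x xb) < delta -> 0 < rho ->
  let Lam := 2 * (L + 1) * K in
  exists xh c lam,
    [/\ norm (vsub xh x) <= rho, norm (vsub (G xh) c) <= phi x + rho,
        C1 (blk1 c), C2 (blk2 c) &
    [/\ reg_normal C1 (blk1 c) (blk1 lam), reg_normal C2 (blk2 c) (blk2 lam),
        norm (blk1 lam) = 1, norm (blk2 lam) <= Lam &
        norm (mtv A lam) <= e + eta0 * (1 + Lam) + rho]].
Proof.
move=> rR bx e01 C2x phix min lin eta00 bxd rho0 Lam.
pose M := (L + 1) * K.
have M0 : 0 < M by apply: Rmult_lt_0_compat; lra.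
have KL0 : 0 <= K * L by apply: Rmult_le_pos; lra.
(* In order: restored points stay in the ball of radius [r], [near_linear] applies, the first
   residual stays positive, and all displacements fit into [rho]. *)
have [s [s0 [sx [sd [sphi srho]]]]] : exists s, 0 < s /\
    (1 + K * L) * s < r - norm (vsub x xb) /\ s < delta - norm (vsub x xb) /\
    L * s < phi x /\ (2 * L + 2) * s <= rho.
  pose m := Rmin (r - norm (vsub x xb)) (Rmin (delta - norm (vsub x xb)) (Rmin (phi x) rho)).
  pose D := 3 + K * L + 2 * L.
  have m0 : 0 < m by do 3 (apply: Rmin_pos; first lra); lra.
  have D1 : 1 <= D by rewrite /D; lra.
  have [m1 [m2 [m3 m4]]] : m <= r - norm (vsub x xb) /\ m <= delta - norm (vsub x xb) /\
      m <= phi x /\ m <= rho.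
    rewrite /m; set a := r - _; set b := delta - _; have := Rmin_l a (Rmin b (Rmin (phi x) rho)).
    have := Rmin_r a (Rmin b (Rmin (phi x) rho)); have := Rmin_l b (Rmin (phi x) rho).
    have := Rmin_r b (Rmin (phi x) rho); have := Rmin_l (phi x) rho; have := Rmin_r (phi x) rho.
    by lra.
  have s0 : 0 < m / D by apply: Rdiv_lt_0_compat; lra.
  have sD : D * (m / D) = m by field; lra.
  by exists (m / D); split=> //; move: sD; rewrite /D; nra.
have bS w : norm (vsub w x) <= s -> norm (vsub w xb) < r.
  by move=> ?; have := norm_sub_tri x w xb; nra.
have bR w : norm (vsub w x) <= s -> norm (vsub w xb) < R0 by move=> /bS; lra.
have bD w : norm (vsub w x) <= s -> norm (vsub w xb) < delta.
  by move=> ?; have := norm_sub_tri x w xb; lra.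
have xx : norm (vsub x x) = 0 by rewrite (_ : vsub x x = @vzero n) ?norm0 //; vec.
have psix : psi x = 0 by apply: setdist_eq0.
have psi0 w : 0 <= psi w by apply: setdist_ge0.
have phi0 w : 0 <= phi w by apply: setdist_ge0.
have psiS w : norm (vsub w x) <= s -> psi w <= L * norm (vsub w x).
  move=> hw; have := psi_lip (bR w hw) (bR x _); rewrite xx psix.
  by move=> /(_ (Rlt_le _ _ s0)); lra.
(* With this [j], completing the square in [key] below gives [q <= s / 4], so the minimizer of [Psi]
   is interior. *)
pose j := 4 * M * M / (s * s).
have j0 : 0 < j by apply: Rdiv_lt_0_compat; nra.
have js : j * (s * s) = 4 * M * M by rewrite /j; field; lra.
pose Psi w := phi w + (e * norm (vsub w x) +
  (norm (vsub w x) * norm (vsub w x) + j * (psi w * psi w))).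
pose S w := norm (vsub w x) <= s.
have [|||||xh [bh minh]] := @min_exists n S Psi (norm x + s).
- exact: closed_ball.
- by exists x; rewrite /S; lra.
- exact: ball_bound.
- move=> w _; have := phi0 w; have := psi0 w; have := norm_ge0 (vsub w x); rewrite /Psi => ? ? ?.
  have : 0 <= j * (psi w * psi w) by apply: Rmult_le_pos; nra.
  by nra.
- have lipd : lip_on S (fun w => norm (vsub w x)) by apply: lip_dist.
  apply: lip_add; first by exists L => y z /bR ? /bR ?; apply: phi_lip.
  apply: lip_add; first by apply: lip_scale; [lra | exact: lipd].
  apply: lip_add.
    by apply: (@lip_sqr _ _ _ s) => // y; split=> //; apply: norm_ge0.
  apply: lip_scale; first lra.
  apply: (@lip_sqr _ _ _ (L * s)) => [y Sy|]; last by exists L => y z /bR ? /bR ?; apply: psi_lip.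
  by split=> //; have := psiS y Sy; rewrite /S in Sy; nra.
rewrite /S in bh; set q := norm (vsub xh x) in bh; set d := psi xh.
have q0 : 0 <= q by apply: norm_ge0.
have d0 : 0 <= d by apply: psi0.
have dL : d <= L * q by apply: psiS.
have [z [C2z dz]] := setdist_proj (blk2 (G xh)) cl2 ne2.
have [y [C1y ay]] := setdist_proj (blk1 (G xh)) cl1 ne1.
rewrite -/(psi xh) -/d in dz; rewrite -/(phi xh) in ay.
(* The point [xh] is restored to the second constraint at cost [K * d]; minimality of [x] against
   the restored point and of [xh] against [x] bounds both quadratic terms linearly in [d]. Division
   by [d] is the multiplier bound [jd]. *)
have key : q * q + j * (d * d) <= M * d.
  have [x' [C2x' hx']] := reg2 (bR xh bh) C2z; rewrite -dz in hx'.
  have bx' : norm (vsub x' xb) <= r.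
    have := norm_sub_tri xh x' xb; have := norm_sub_tri x xh xb.
    rewrite (norm_subC x' xh) -/q.
    have : K * d <= K * L * s by rewrite Rmult_assoc; apply: Rmult_le_compat_l; nra.
    by lra.
  have h1 := min x' bx' C2x'.
  have h2 : phi x' - phi xh <= L * norm (vsub x' xh).
    apply: phi_lip; [lra | exact: bR].
  have h3 := minh x (Rle_trans _ _ _ (Req_le _ _ xx) (Rlt_le _ _ s0)).
  rewrite /Psi xx psix -/d -/q in h3; rewrite (norm_subC x') in h2.
  have h4 := norm_sub_tri xh x x'; rewrite (norm_subC x xh) -/q in h4.
  have h5 := Rmult_le_compat_l e _ _ ltac:(lra) h4.
  have h6 := Rmult_le_compat_l (L + e) _ _ ltac:(lra) hx'.
  have h7 : (L + e) * (K * d) <= (L + 1) * (K * d).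
    by apply: Rmult_le_compat_r; [apply: Rmult_le_pos; lra | lra].
  by rewrite /M; lra.
have qs : q <= s / 4.
  apply: Rnot_lt_le => lt.
  have h : s / 4 * (s / 4) < q * q by apply: Rmult_le_0_lt_compat; lra.
  have h1 := Rle_0_sqr (2 * (j * d) - M); rewrite /Rsqr in h1.
  have h2 : 4 * (j * (q * q)) + 4 * (j * j * (d * d)) <= 4 * (j * (M * d)) by nra.
  have h3 : j * (s / 4 * (s / 4)) < j * (q * q) by apply: Rmult_lt_compat_l.
  by nra.
have jd : j * d <= M.
  have [->|dpos] : d = 0 \/ 0 < d by lra.
    by lra.
  by apply: (Rmult_le_reg_r d) => //; nra.
have hphi : phi xh <= phi x + L * q by have := phi_lip (bR xh bh) (bR x ltac:(lra)); rewrite -/q; lra.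
have hphi' : phi x - phi xh <= L * q.
  by have := phi_lip (bR x ltac:(lra)) (bR xh bh); rewrite norm_subC -/q.
have Lq : L * q <= L * s by apply: Rmult_le_compat_l.
set a := vsub (blk1 (G xh)) y in ay; set b := vsub (blk2 (G xh)) z in dz.
have a0 : 0 < norm a by rewrite -ay; lra.
(* Gradients at the projections: a unit vector for the plain distance, [2 * j] times the
   displacement for the squared one. *)
pose lam := vjoin (vscal (/ norm a) a) (vscal (2 * j) b).
have lam1 : norm (blk1 lam) = 1.
  rewrite /lam blk1_join normZ_ge0; first by field; lra.
  by apply/Rlt_le/Rinv_0_lt_compat.
have lam2 : norm (blk2 lam) <= Lam.
  by rewrite /lam blk2_join normZ_ge0 -?dz /Lam; [rewrite /M in jd; lra | lra].
exists xh, (vjoin y z), lam; split.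
- by rewrite -/q; nra.
- apply: Rle_trans (norm_blk _) _.
  rewrite -[blk1 (vsub _ _)]/(vsub (blk1 _) (blk1 _)) -[blk2 (vsub _ _)]/(vsub (blk2 _) (blk2 _)).
  by rewrite blk1_join blk2_join -/a -/b -ay -dz; nra.
- by rewrite blk1_join.
- by rewrite blk2_join.
split=> //; [| |].
- rewrite /lam !blk1_join; apply: projection_normal => //.
  by apply/Rlt_le/Rinv_0_lt_compat.
- by rewrite /lam !blk2_join; apply: projection_normal => //; lra.
have Lam0 : 0 <= Lam by apply: Rle_trans lam2; apply: norm_ge0.
apply: (Rle_trans _ (e + eta0 * (1 + Lam) + 2 * q)); last by nra.
(* The quadratic coefficient collects the squared distance to [x], the distance to [C1] and the
   penalty, and [2 * q] is the gradient length of the first. Steps up to [s / 2] from [xh] stay in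
   the ball of radius [s]. *)
apply: (@approx_stationary _ _ _ (1 + L * L / (2 * norm a) + j * (L * L)) (s / 2)); first lra.
  by have := Rmult_le_pos _ _ eta00 (Rplus_le_le_0_compat _ _ Rle_0_1 Lam0); lra.
move=> h hs; have nh0 := norm_ge0 h; set N := norm h in hs nh0.
pose xn := vadd xh h.
have xnxh : vsub xn xh = h by rewrite /xn; vec.
have xnx : norm (vsub xn x) <= q + N.
  by have := norm_sub_tri xh xn x; rewrite xnxh -/q -/N; lra.
have bn : norm (vsub xn x) <= s by lra.
pose w := vsub (G xn) (G xh).
have wL : norm w <= L * N by have := lipG (bR _ bn) (bR _ bh); rewrite xnxh.
have w1L : norm (blk1 w) <= L * N by apply: Rle_trans (norm_blk1 _) wL.
have w2L : norm (blk2 w) <= L * N by apply: Rle_trans (norm_blk2 _) wL.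
have hn := minh xn bn; rewrite /Psi -/q -/d in hn.
(* Freezing the projection [y] of [xh] replaces the distance by a norm that majorizes it and agrees
   with it at [xh]; [psin] does the same with [z]. *)
have phin : phi xn <= phi xh + dot (blk1 lam) (blk1 w) + L * L / (2 * norm a) * (N * N).
  have := setdist_le (blk1 (G xn)) C1y; rewrite -/(phi xn).
  rewrite (_ : vsub _ y = vadd a (blk1 w)); last first.
    by rewrite /a /w /blk1; vec.
  have := norm_add_le (blk1 w) a0; rewrite /lam blk1_join -ay => h1 h2.
  suff : norm (blk1 w) * norm (blk1 w) / (2 * phi xh) <= L * L / (2 * phi xh) * (N * N) by lra.
  rewrite (_ : L * L / (2 * phi xh) * (N * N) = (L * N) * (L * N) / (2 * phi xh));
    last by field; lra.
  apply: Rmult_le_compat_r; first by apply/Rlt_le/Rinv_0_lt_compat; lra.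
  by apply: Rmult_le_compat => //; apply: norm_ge0.
have psin : j * (psi xn * psi xn) <= j * (d * d) + dot (blk2 lam) (blk2 w) + j * (L * L) * (N * N).
  have := setdist_le (blk2 (G xn)) C2z; rewrite -/(psi xn).
  rewrite (_ : vsub _ z = vadd b (blk2 w)); last first.
    by rewrite /b /w /blk2; vec.
  have := norm_add_sq b (blk2 w); rewrite -dz /lam blk2_join dotZl => h1 h2.
  have h3 : psi xn * psi xn <= norm (vadd b (blk2 w)) * norm (vadd b (blk2 w)).
    by apply: Rmult_le_compat.
  have h4 : norm (blk2 w) * norm (blk2 w) <= (L * N) * (L * N).
    by apply: Rmult_le_compat => //; apply: norm_ge0.
  have h5 : j * (psi xn * psi xn) <= j * (d * d + 2 * dot b (blk2 w) + (L * N) * (L * N)).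
    by apply: Rmult_le_compat_l; lra.
  by lra.
have sq : norm (vsub xn x) * norm (vsub xn x) <= q * q + 2 * q * N + N * N.
  have : norm (vsub xn x) * norm (vsub xn x) <= (q + N) * (q + N).
    by apply: Rmult_le_compat => //; apply: norm_ge0.
  by lra.
have en : e * norm (vsub xn x) <= e * (q + N) by apply: Rmult_le_compat_l; lra.
have dw : dot (blk1 lam) (blk1 w) + dot (blk2 lam) (blk2 w)
    <= dot (mtv A lam) h + eta0 * (1 + Lam) * N.
  rewrite -dot_blk -dot_mv; have := lin _ _ (bD _ bn) (bD _ bh); rewrite xnxh -/w -/N => hw.
  have := cauchy_schwarz lam (vsub w (mv A h)); rewrite dotBr.
  have : norm lam <= 1 + Lam by apply: Rle_trans (norm_blk _) _; lra.
  move=> nl; have := Rmult_le_compat _ _ _ _ (norm_ge0 _) (norm_ge0 _) nl hw.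
  by lra.
by rewrite -/N; lra.
Qed.

End Penalization.

(** * Passage to the limit *)

Lemma eta_mul_small c e : 0 <= c -> 0 < e ->
  exists N, forall k, (N <= k)%nat -> c * eta k < e.
Proof.
move=> c0 e0; have e'0 : 0 < e / (c + 1) by apply: Rdiv_lt_0_compat; lra.
have [N hN] := eta_small e'0; exists N => k /hN lt.
have := Rmult_lt_compat_l (c + 1) _ _ ltac:(lra) lt.
rewrite (_ : (c + 1) * (e / (c + 1)) = e); last by field; lra.
by have := eta_gt0 k; lra.
Qed.

Lemma le_eta_le0 c x : 0 <= c -> (forall k, x <= c * eta k) -> x <= 0.
Proof.
move=> c0 h; apply: Rnot_lt_le => x0; have [N hN] := eta_mul_small c0 x0.
by have := hN N (leqnn N); have := h N; lra.
Qed.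

Lemma proper_seq T (Q : nat -> T -> Prop) : nonvoid Q -> exists s, forall k, Q k (s k).
Proof.
move=> h; exists (fun k => proj1_sig (constructive_indefinite_description _ (h k))) => k.
by case: constructive_indefinite_description.
Qed.

Lemma im_deriv0 (P : Type) n l (g : P -> vec n -> vec l) Dg zeta pb xb :
  im_deriv g Dg zeta pb xb (@vzero l).
Proof. by []. Qed.

Lemma im_deriv_scale (P : Type) n l (g : P -> vec n -> vec l) Dg zeta pb xb a v :
  0 <= a -> im_deriv g Dg zeta pb xb v -> im_deriv g Dg zeta pb xb (vscal a v).
Proof. by move=> a0 h K cK kK K0 gK; exact: kK a0 (h K cK kK K0 gK). Qed.

Section Stability.

Variables (P : Type) (T : topology P) (n l1 l2 : nat).
Variables (g : P -> vec n -> vec (l1 + l2)) (Dg : P -> vec n -> mat (l1 + l2) n).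
Variables (C1 : vec l1 -> Prop) (C2 : vec l2 -> Prop).
Variables (pb : P) (xb : vec n) (zeta : P -> R).

Let C := fun y : vec (l1 + l2) => C1 (blk1 y) /\ C2 (blk2 y).
Let A := Dg pb xb.
Let yb := g pb xb.

Hypotheses (cl1 : is_closed C1) (cl2 : is_closed C2) (Cyb : C yb).

(** The Lipschitz constant is [mnorm A] plus the linearization error at index 0. This bound and the
    stability of the second block need no improvement with [k], so they are tied to [W 0] alone. *)
Lemma uniform_neighborhoods :
  standing T g Dg pb xb -> cont_at T zeta pb ->
  robinson_stable T (fun p x => blk2 (g p x)) C2 pb xb ->
  exists (W : nat -> P -> Prop) (delta : nat -> R) R0 L K,
    [/\ 0 < R0, 0 <= L, 0 < K, forall k, 0 < delta k &
    [/\ forall k, nbhd_P T (W k) pb, antitone W,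
      forall k p, W k p ->
        [/\ near_linear (g p) A xb (delta k) (eta k), norm (vsub (g p xb) yb) < eta k,
            mnorm (msub (Dg p xb) A) < eta k & Rabs (zeta p - zeta pb) < eta k],
      forall p x x', W 0%nat p -> norm (vsub x xb) < R0 -> norm (vsub x' xb) < R0 ->
        norm (vsub (g p x) (g p x')) <= L * norm (vsub x x') &
      forall p x y, W 0%nat p -> norm (vsub x xb) < R0 -> C2 y ->
        exists x', C2 (blk2 (g p x')) /\
          norm (vsub x x') <= K * norm (vsub (blk2 (g p x)) y)]].
Proof.
move=> st cz rob.
have [K [Vb [db [K0 [nVb [db0 reg]]]]]] := robinson_elim (ex_intro _ _ (proj2 Cyb)) rob.
have hV k : exists Vd : (P -> Prop) * R, nbhd_P T Vd.1 pb /\ 0 < Vd.2 /\ forall p, Vd.1 p ->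
    [/\ near_linear (g p) A xb Vd.2 (eta k), norm (vsub (g p xb) yb) < eta k,
        mnorm (msub (Dg p xb) A) < eta k, Rabs (zeta p - zeta pb) < eta k & Vb p].
  have [V [d [nV [d0 h]]]] := standing_near_linear st (eta_gt0 k).
  have [Vz [nVz hz]] := cz _ (eta_gt0 k).
  exists (fun p => V p /\ (Vz p /\ Vb p), d); split; first by do 2 apply: nbhd_and => //.
  split=> // p [/h [? ? ?] [/hz ? ?]]; by split.
have [Vd hVd] := proper_seq hV.
pose W k p := forall j, (j <= k)%nat -> (Vd j).1 p.
have W0 p : W 0%nat p -> (Vd 0%nat).1 p by apply.
exists W, (fun k => (Vd k).2), (Rmin (Vd 0%nat).2 db), (mnorm A + 1), K.
have d0 k : 0 < (Vd k).2 by have [_ []] := hVd k.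
split=> //; [exact: Rmin_pos | by have := mnorm_ge0 A; lra | split].
- by apply: nbhd_chain => k; have [] := hVd k.
- by move=> j k p jk Wk i ij; apply/Wk/(leq_trans ij).
- by move=> k p /(_ k (leqnn k)) Wk; have [_ [_ /(_ p Wk) []]] := hVd k.
- move=> p x x' /W0 Vp hx hx'; have [_ [_ /(_ p Vp) [lin _ _ _ _]]] := hVd 0%nat.
  have := lin x x'; have := Rmin_l (Vd 0%nat).2 db => ml.
  move=> /(_ ltac:(lra) ltac:(lra)) h.
  have := norm_le_sub (vsub (g p x) (g p x')) (mv A (vsub x x')).
  have := mv_bound A (vsub x x'); have := eta_le1 0; have := norm_ge0 (vsub x x').
  by nra.
- move=> p x y /W0 Vp hx Cy; have [_ [_ /(_ p Vp) [_ _ _ _ Vbp]]] := hVd 0%nat.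
  by apply: reg => //; have := Rmin_r (Vd 0%nat).2 db; lra.
Qed.

(** * Data violating stability, relative to a fixed system of neighborhoods *)

Variables (W : nat -> P -> Prop) (delta : nat -> R) (R0 L K : R).
Hypotheses (R00 : 0 < R0) (L0 : 0 <= L) (K0 : 0 < K) (delta0 : forall k, 0 < delta k).
Hypotheses (nW : forall k, nbhd_P T (W k) pb) (decW : antitone W).
Hypothesis hW : forall k p, W k p ->
  [/\ near_linear (g p) A xb (delta k) (eta k), norm (vsub (g p xb) yb) < eta k,
      mnorm (msub (Dg p xb) A) < eta k & Rabs (zeta p - zeta pb) < eta k].
Hypothesis lipg : forall p x x', W 0%nat p ->
  norm (vsub x xb) < R0 -> norm (vsub x' xb) < R0 ->
  norm (vsub (g p x) (g p x')) <= L * norm (vsub x x').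
Hypothesis regg : forall p x y, W 0%nat p -> norm (vsub x xb) < R0 -> C2 y ->
  exists x', C2 (blk2 (g p x')) /\ norm (vsub x x') <= K * norm (vsub (blk2 (g p x)) y).

Let ne1 : exists y, C1 y := ex_intro _ _ (proj1 Cyb).
Let ne2 : exists y, C2 y := ex_intro _ _ (proj2 Cyb).

(* A parameter, a penalized minimizer [pt] for it, a nearby point [pt'] whose
   image is projected to [im] in [C], and the normal [mult] at [im]. *)
Record datum := Datum {
  par : P; pt : vec n; pt' : vec n; im : vec (l1 + l2); mult : vec (l1 + l2) }.

Definition pdist d := norm (vsub (g (par d) xb) yb).
Definition scale d := pdist d + norm (vsub (pt d) xb).
Definition res p x := setdist (blk1 (g p x)) C1.
Definition Lam := 2 * (L + 1) * K.

(** The ball of competitors has a radius independent of [k], so any competitors tending to [xb] are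
    eventually admissible. *)
Definition near_optimal (k : nat) (d : datum) : Prop :=
  [/\ W k (par d), norm (vsub (pt d) xb) < eta k, 0 < scale d &
      forall z, norm (vsub z xb) <= R0 / 2 -> C2 (blk2 (g (par d) z)) ->
        res (par d) (pt d) <= res (par d) z + eta k * norm (vsub (pt d) z)].

(** Errors of points and images are relative to [scale d], by which they are divided when directions
    are formed. The factor [3 + Lam] adds 1 for the Ekeland slope, [1 + Lam] for linearization and 1
    for penalization. *)
Definition near_critical (k : nat) (d : datum) : Prop :=
  [/\ norm (vsub (pt' d) (pt d)) <= scale d * eta k,
      norm (vsub (g (par d) (pt' d)) (im d)) <= res (par d) (pt d) + scale d * eta k,
      C (im d) &
  [/\ reg_normal C1 (blk1 (im d)) (blk1 (mult d)), reg_normal C2 (blk2 (im d)) (blk2 (mult d)),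
      norm (blk1 (mult d)) = 1, norm (blk2 (mult d)) <= Lam &
      norm (mtv A (mult d)) <= (3 + Lam) * eta k]].

Definition bad k d := near_optimal k d /\ near_critical k d.

Lemma Lam_ge0 : 0 <= Lam.
Proof. by apply: Rmult_le_pos; lra. Qed.

Lemma pdist_ge0 d : 0 <= pdist d. Proof. exact: norm_ge0. Qed.

Lemma bad_antitone : antitone bad.
Proof.
move=> j k d jk [[Wd bx t0 opt] [h1 h2 Cd [r1 r2 n1 n2 crit]]].
have e := eta_decr jk; have Lam0 := Lam_ge0.
have te : scale d * eta k <= scale d * eta j by apply: Rmult_le_compat_l; lra.
split; split=> //; [exact: decW Wd|lra| |lra|lra|].
- move=> z bz C2z; have := opt z bz C2z.
  by have := Rmult_le_compat_r _ _ _ (norm_ge0 (vsub (pt d) z)) e; lra.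
- by split=> //; nra.
Qed.

(** Stability is refuted with the constant [kap] dictated by the tolerance [eta k]. As [kap] is
    large for small [eta k], the index [m] of the neighborhood is chosen after it. *)
Lemma bad_nonvoid : ~ robinson_stable T g C pb xb -> nonvoid bad.
Proof.
move=> unst k; have ek := eta_gt0 k; have Lam0 := Lam_ge0.
have LK0 : 0 <= L * K by apply: Rmult_le_pos; lra.
pose kap := K + (1 + L * K) / eta k.
have kap0 : 0 < kap.
  by have : 0 < (1 + L * K) / eta k by [apply: Rdiv_lt_0_compat; lra]; rewrite /kap; lra.
pose rho := Rmin (R0 / 2) (Rmin (delta k) (eta k)).
have rho0 : 0 < rho by do 2 (apply: Rmin_pos; first by [lra | apply: delta0]).
have [rhoR [rhod rhoe]] : rho <= R0 / 2 /\ rho <= delta k /\ rho <= eta k.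
  have := Rmin_l (R0 / 2) (Rmin (delta k) (eta k)); have := Rmin_r (R0 / 2) (Rmin (delta k) (eta k)).
  by have := Rmin_l (delta k) (eta k); have := Rmin_r (delta k) (eta k); rewrite -/rho; lra.
have [N hN] := eta_mul_small (Rlt_le _ _ kap0) (Rdiv_lt_0_compat _ _ rho0 Rlt_0_2).
pose m := maxn k N.
have kL0 : 0 <= kap * L by apply: Rmult_le_pos; lra.
(* The distance of [x0] to [xb], with its Lipschitz effect on the image, takes one half of [rho] in
   [close]; [kap * eta m] takes the other. *)
pose dl := rho / (2 * (1 + kap * L)).
have dl0 : 0 < dl by apply: Rdiv_lt_0_compat; lra.
have dlE : dl * (1 + kap * L) = rho / 2 by rewrite /dl; field; lra.
have [p [x0 [y0 [Wp [bx0 [Cy0 [near far]]]]]]] : exists p x0 y0, W m p /\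
    norm (vsub x0 xb) < dl /\ C y0 /\
    norm (vsub (g p x0) y0) <= norm (vsub (g p x0) yb) /\
    forall x, C (g p x) -> kap * norm (vsub (g p x0) y0) < norm (vsub x0 x).
  apply: NNPP => no; apply: unst.
  apply: (@robinson_intro _ T pb n _ g C xb yb kap (W m) dl) => //; first lra.
  move=> p x y Wp bx Cy le; apply: NNPP => no'; apply: no; exists p, x, y; do 4 split=> //.
  by move=> x' Cx'; apply: Rnot_le_lt => ?; apply: no'; exists x'.
have Wk : W k p by apply: decW Wp; apply: leq_maxl.
have W0 : W 0%nat p by apply: decW Wp.
have [_ gm _ _] := hW Wp.
have [lin gk _ _] := hW Wk.
have lip := fun x x' => @lipg p x x' W0.
have reg := fun x y => @regg p x y W0.
have xx : norm (vsub xb xb) = 0 by rewrite (_ : vsub xb xb = @vzero n) ?norm0 //; vec.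
have dlr : dl <= rho / 2 by have := Rmult_le_pos _ _ (Rlt_le _ _ dl0) kL0; lra.
have close : norm (vsub x0 xb) + kap * norm (vsub (g p x0) y0) < rho.
  have h1 := norm_sub_tri (g p xb) (g p x0) yb.
  have h2 := lip x0 xb ltac:(lra) ltac:(lra).
  have h3 : kap * norm (vsub (g p x0) y0) <= kap * (L * norm (vsub x0 xb) + eta m).
    by apply: Rmult_le_compat_l; lra.
  have h4 := hN m (leq_maxr _ _).
  have h5 := Rmult_lt_compat_r (1 + kap * L) _ _ ltac:(lra) bx0.
  by lra.
have R2 : R0 / 2 < R0 by lra.
have [x [bx C2x phix opt]] := penalized_minimizer cl1 cl2 ne1 L0 K0 lip reg R2 rhoR ek
  (proj1 Cy0) (proj2 Cy0) close (fun x c1 c2 => far x (conj c1 c2)).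
pose t := norm (vsub (g p xb) yb) + norm (vsub x xb).
(* Otherwise [x] would be [xb] with image [yb] in [C], against the positive residual. *)
have t0 : 0 < t.
  have := norm_ge0 (vsub (g p xb) yb); have := norm_ge0 (vsub x xb) => h1 h2.
  apply: Rnot_le_lt => le; move: phix; rewrite (_ : x = xb); last by apply: vsub_eq; rewrite /t in le; lra.
  rewrite (_ : g p xb = yb); last by apply: vsub_eq; rewrite /t in le; lra.
  by rewrite setdist_eq0; [lra | case: Cyb].
(* One tolerance below both [t * eta k], for points and images, and [eta k], for the multiplier
   equation. *)
have rho'0 : 0 < Rmin t 1 * eta k by apply: Rmult_lt_0_compat => //; apply: Rmin_pos; lra.
have [xh [c [lam [h1 h2 h3 h4 [h5 h6 h7 h8 h9]]]]] :=
  approximate_multiplier cl1 cl2 ne1 ne2 L0 K0 lip reg R2 (Rlt_le_trans _ _ _ bx rhoR)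
    (conj ek (eta_le1 k)) C2x phix opt lin (Rlt_le _ _ ek) (Rlt_le_trans _ _ _ bx rhod) rho'0.
rewrite -/Lam in h8 h9.
have m1 : Rmin t 1 * eta k <= t * eta k by apply: Rmult_le_compat_r; [lra | apply: Rmin_l].
have m2 : Rmin t 1 * eta k <= 1 * eta k by apply: Rmult_le_compat_r; [lra | apply: Rmin_r].
exists (Datum p x xh c lam); split; split=> //=; rewrite /scale /pdist /= -/t.
- by lra.
- by lra.
- by rewrite /res; lra.
- by split=> //; lra.
Qed.

(* By (a), [xb + tau u] is feasible up to o(tau); comparing the near-minimizers
   with a nearby point that is feasible for the second block makes their
   residual negligible. *)
Lemma small_residual :
  (forall v, im_deriv g Dg zeta pb xb v -> forall t : nat -> R, tdown t ->
     exists u : vec n,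
       liminf_eq0 (fun k => setdist (vadd yb (vscal (t k) (vadd v (mv A u)))) C / t k)) ->
  nonvoid bad ->
  exists w, im_deriv g Dg zeta pb xb w /\
    let Q k d := [/\ bad k d, res (par d) (pt d) <= scale d * eta k &
      norm (vsub (vsub (g (par d) xb) yb) (vscal (pdist d) w)) <= pdist d * eta k] in
    antitone Q /\ nonvoid Q.
Proof.
move=> aubin prop.
suff [w [Dw hw]] : exists w, im_deriv g Dg zeta pb xb w /\ forall m, exists d,
    [/\ bad m d, res (par d) (pt d) <= scale d * eta m &
      norm (vsub (vsub (g (par d) xb) yb) (vscal (pdist d) w)) <= pdist d * eta m].
  exists w; split=> //; split=> // j k d jk [bd h1 h2]; have e := eta_decr jk.
  split; first exact: bad_antitone bd.
  - have [[_ _ t0 _] _] := bd.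
    by have := Rmult_le_compat_l _ _ _ (Rlt_le _ _ t0) e; lra.
  - by have := Rmult_le_compat_l _ _ _ (pdist_ge0 d) e; lra.
(* If [pdist d = 0] occurs at every level, [xb] itself is a feasible competitor and w = 0 works;
   otherwise directions are defined from level [k0] on. *)
have [zero|/not_all_ex_not [k0 hk0]] :=
  classic (forall k, exists d, bad k d /\ pdist d = 0).
  exists (@vzero (l1 + l2)); split; first exact: im_deriv0.
  move=> m; have [d [bd z]] := zero m; exists d.
  have gx : g (par d) xb = yb by apply: vsub_eq; rewrite -/(pdist d); lra.
  split=> //; last first.
    rewrite gx z (_ : vsub _ _ = @vzero (l1 + l2)); last by vec.
    by rewrite norm0; lra.
  have [[Wd _ _ opt] _] := bd; have := opt xb.
  have -> : res (par d) xb = 0 by rewrite /res gx setdist_eq0 //; case: Cyb.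
  rewrite gx (_ : vsub xb xb = @vzero n) ?norm0; last by vec.
  by move=> /(_ ltac:(lra) (proj2 Cyb)); rewrite /scale z; lra.
pose Q k d := bad (maxn k k0) d.
have pos k d : Q k d -> 0 < pdist d.
  move=> Qd; have [//|le] := Rlt_le_dec 0 (pdist d); case: hk0; exists d.
  split; last by have := pdist_ge0 d; lra.
  exact: bad_antitone (leq_maxr _ _) Qd.
have badQ k d : Q k d -> bad k d by apply: bad_antitone; apply: leq_maxl.
pose dir d := vscal (/ pdist d) (vsub (g (par d) xb) yb).
have [|k|d /pos p0|w [_ propw]] := @refine _ Q _ dir 1.
- move=> j k d jk; apply: bad_antitone.
  by rewrite geq_max leq_maxr (leq_trans jk) // leq_maxl.
- exact: prop.
- rewrite /dir normZ_ge0; last by apply/Rlt_le/Rinv_0_lt_compat.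
  by rewrite -/(pdist d) Rinv_l; lra.
have [s hs] := proper_seq propw.
pose tau k := pdist (s k).
have tau0 k : 0 < tau k by apply: pos (hs k).1.
have Ws k : W k (par (s k)) by have [/badQ [[? _ _ _] _] _] := hs k.
have taue k : tau k < eta k by have [] := hW (Ws k).
have Dw : im_deriv g Dg zeta pb xb w.
  move=> S _ _ _; apply; exists (fun k => par (s k)); split.
    by move=> k; have [_ ? ? ?] := hW (Ws k); split; [split=> //; exact: tau0 | split].
  move=> e /eta_small [N hN]; exists N => k /hN lt; apply: Rlt_trans lt.
  exact: (hs k).2.
have dtau : tdown tau.
  split=> // e /eta_small [N hN]; exists N => k /hN; have := taue k; lra.
have [u [lim0 _]] := aubin w Dw tau dtau.
exists w; split=> // m; set U := norm u.
have U0 : 0 <= U by apply: norm_ge0.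
have LK0 : 0 <= L * K by apply: Rmult_le_pos; lra.
pose KU := K * (U + 2); have KU0 : 0 <= KU by apply: Rmult_le_pos; lra.
have LKU0 : 0 <= L * KU by apply: Rmult_le_pos; lra.
(* The sum of the coefficients with which [e] enters the final comparison. *)
pose B := U + 2 + L * KU + 1 + U + KU.
have em := eta_gt0 m; have em1 := eta_le1 m.
pose e := eta m / B.
have B1 : 1 <= B by rewrite /B; lra.
have e0 : 0 < e by apply: Rdiv_lt_0_compat; lra.
have eB : e * B = eta m by rewrite /e; field; lra.
have e1 : e <= 1 by nra.
have [N1 hN1] := eta_small e0.
have [dR0 [dRR dRd]] : 0 < Rmin (R0 / 2) (delta N1) /\ Rmin (R0 / 2) (delta N1) <= R0 / 2 /\
    Rmin (R0 / 2) (delta N1) <= delta N1.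
  by split; [apply: Rmin_pos => //; lra | split; [apply: Rmin_l | apply: Rmin_r]].
(* The competitor [x0] and its restoration [z] both lie within [tk * (U + KU)] of [xb]. *)
have [N2 hN2] := @eta_mul_small (U + KU) _ ltac:(lra) dR0.
(* A limit inferior is enough, since each [m] requires a single late index. *)
have [k [kN lt]] := lim0 e e0 (maxn m (maxn N1 N2)).
have km : (m <= k)%nat by apply: leq_trans kN; apply: leq_maxl.
have kN1 : (N1 <= k)%nat by apply: leq_trans kN; rewrite !leq_max leqnn orbT.
have kN2 : (N2 <= k)%nat by apply: leq_trans kN; rewrite !leq_max leqnn !orbT.
have [/badQ bd dirw] := hs k; have tk0 := tau0 k; have tke := taue k.
have ek := hN1 k kN1; have eN1 := hN1 N1 (leqnn _); have ek0 := eta_gt0 k.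
have small := hN2 k kN2.
have dke : tau k * eta k <= tau k * e by apply: Rmult_le_compat_l; lra.
move: bd dirw lt tk0 tke dke; rewrite /tau; set d := s k; set tk := pdist d.
move=> bd dirw lt tk0 tke dke.
have gw : norm (vsub (vsub (g (par d) xb) yb) (vscal tk w)) <= tk * eta k.
  rewrite (_ : vsub _ _ = vscal tk (vsub (dir d) w)).
    by rewrite normZ_ge0; [apply: Rmult_le_compat_l | ]; lra.
  apply: functional_extensionality => i; rewrite /dir /vsub /vscal -/tk.
  by field; lra.
exists d; split; first exact: bad_antitone bd; last first.
  by have := Rmult_le_compat_l _ _ _ (Rlt_le _ _ tk0) (eta_decr km); rewrite -/tk; lra.
have [[Wd bx t0 opt] _] := bd.
have W0 : W 0%nat (par d) by apply: decW Wd.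
have [y [[C1y C2y] hy]] : exists y, C y /\
    norm (vsub (vadd yb (vscal tk (vadd w (mv A u)))) y) < e * tk.
  apply: setdist_near; first by exists yb.
  have := Rmult_lt_compat_r _ _ _ tk0 lt.
  set q := setdist _ _; by rewrite (_ : q / tk * tk = q) //; field; lra.
pose x0 := vadd xb (vscal tk u).
have x0b : vsub x0 xb = vscal tk u by rewrite /x0; vec.
have nx0 : norm (vsub x0 xb) = tk * U by rewrite x0b normZ_ge0 -?/U; lra.
have xx : norm (vsub xb xb) = 0 by rewrite (_ : vsub xb xb = @vzero n) ?norm0 //; vec.
have tU : tk * (U + KU) <= (U + KU) * eta k by rewrite Rmult_comm; apply: Rmult_le_compat_l; lra.
have tU0 : 0 <= tk * U by apply: Rmult_le_pos; lra.
have tKU0 : 0 <= tk * KU by apply: Rmult_le_pos; lra.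
(* The coefficient [U + 2] consists of [U] from linearization, 1 from the direction [w] and 1 from
   (a). *)
have near : norm (vsub (g (par d) x0) y) <= tk * (U + 2) * e.
  have [lin _ _ _] := hW (decW kN1 Wd).
  have := lin x0 xb; rewrite nx0 xx => /(_ ltac:(lra) ltac:(lra)) h1.
  have h2 : eta N1 * (tk * U) <= e * (tk * U) by apply: Rmult_le_compat_r; lra.
  rewrite (_ : vsub (g (par d) x0) y =
    vadd (vsub (vsub (g (par d) x0) (g (par d) xb)) (mv A (vsub x0 xb)))
      (vadd (vsub (vsub (g (par d) xb) yb) (vscal tk w))
         (vsub (vadd yb (vscal tk (vadd w (mv A u)))) y))); last by rewrite x0b mvZ; vec.
  apply: Rle_trans (norm_tri _ _) _.
  have := norm_tri (vsub (vsub (g (par d) xb) yb) (vscal tk w))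
         (vsub (vadd yb (vscal tk (vadd w (mv A u)))) y).
  by lra.
have bx0 : norm (vsub x0 xb) < R0 by rewrite nx0; lra.
have [z [C2z hz]] := regg W0 bx0 C2y.
have {}hz : norm (vsub x0 z) <= tk * KU * e.
  apply: Rle_trans hz _; rewrite /KU.
  have h : norm (vsub (blk2 (g (par d) x0)) (blk2 y)) <= tk * (U + 2) * e.
    exact: Rle_trans (norm_blk2 (vsub (g (par d) x0) y)) near.
  by have := Rmult_le_compat_l _ _ _ (Rlt_le _ _ K0) h; lra.
have tKe : tk * KU * e <= tk * KU * 1 by apply: Rmult_le_compat_l.
have bz : norm (vsub z xb) <= tk * U + tk * KU.
  by have := norm_sub_tri x0 z xb; rewrite nx0 (norm_subC z x0); lra.
have resz : res (par d) z <= tk * (U + 2) * e + L * (tk * KU * e).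
  have h1 : res (par d) x0 <= norm (vsub (g (par d) x0) y).
    apply: Rle_trans (setdist_le _ C1y) _; exact: (norm_blk1 (vsub (g (par d) x0) y)).
  have h2 : norm (vsub (g (par d) z) (g (par d) x0)) <= L * norm (vsub z x0).
    by apply: lipg => //; lra.
  have h3 := setdist_lip (blk1 (g (par d) z)) (blk1 (g (par d) x0)) ne1.
  have h4 : norm (vsub (blk1 (g (par d) z)) (blk1 (g (par d) x0))) <= L * norm (vsub z x0).
    exact: Rle_trans (norm_blk1 (vsub (g (par d) z) (g (par d) x0))) h2.
  have h5 := Rmult_le_compat_l _ _ _ L0 hz.
  by rewrite /res in h1 *; rewrite (norm_subC z x0) in h4; lra.
have := opt z ltac:(lra) C2z.
have dz : norm (vsub (pt d) z) <= norm (vsub (pt d) xb) + tk * U + tk * KU.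
  by have := norm_sub_tri xb (pt d) z; rewrite (norm_subC xb z); lra.
have dz' : eta k * norm (vsub (pt d) z) <= e * (norm (vsub (pt d) xb) + tk * U + tk * KU).
  by apply: Rmult_le_compat; try lra; apply: norm_ge0.
have tks : tk <= scale d by rewrite /scale -/tk; have := norm_ge0 (vsub (pt d) xb); lra.
have hB : tk * (U + 2) + L * (tk * KU) + norm (vsub (pt d) xb) + tk * U + tk * KU <= scale d * B.
  have : tk * (U + 2 + L * KU + U + KU) <= scale d * (U + 2 + L * KU + U + KU).
    by apply: Rmult_le_compat_r; lra.
  by rewrite /B; have : norm (vsub (pt d) xb) <= scale d by [rewrite /scale -/tk; lra]; lra.
have := Rmult_le_compat_l _ _ _ (Rlt_le _ _ e0) hB.
rewrite (_ : e * (scale d * B) = scale d * eta m); last by rewrite -eB; ring.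
by lra.
Qed.

(** The ratio of [pdist] to [scale], the scaled point displacement and the multiplier are all
    bounded, so they can be made to converge together. Nontriviality survives because two lengths
    add up to [scale] and the first multiplier block has norm one. *)
Lemma limit_multiplier w :
  im_deriv g Dg zeta pb xb w ->
  (let Q k d := [/\ bad k d, res (par d) (pt d) <= scale d * eta k &
      norm (vsub (vsub (g (par d) xb) yb) (vscal (pdist d) w)) <= pdist d * eta k] in
    antitone Q /\ nonvoid Q) ->
  exists v u lam, [/\ im_deriv g Dg zeta pb xb v,
    ~ (v = @vzero (l1 + l2) /\ u = @vzero n),
    contingent C yb (vadd v (mv A u)), blk1 lam <> @vzero l1 &
    [/\ dir_normal C1 (blk1 yb) (blk1 (vadd v (mv A u))) (blk1 lam),
        dir_normal C2 (blk2 yb) (blk2 (vadd v (mv A u))) (blk2 lam) &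
        mtv A lam = @vzero n]].
Proof.
move=> Dw; set Q := fun k d => _; move=> [decQ propQ].
have Lam0 := Lam_ge0.
have badQ k d : Q k d -> bad k d by case.
have scl k d : Q k d -> 0 < scale d by move=> /badQ [[]].
have ratio d : 0 < scale d -> 0 <= pdist d / scale d <= 1.
  move=> t0; have := pdist_ge0 d; have := norm_ge0 (vsub (pt d) xb) => h1 h2; split.
    by apply: Rmult_le_pos => //; apply/Rlt_le/Rinv_0_lt_compat.
  apply: (Rmult_le_reg_r (scale d)) => //.
  by rewrite (_ : pdist d / scale d * scale d = pdist d); [rewrite /scale; lra | field; lra].
(* The scalar ratio is treated as a vector of dimension one so that [refine] applies. *)
have [d /scl /ratio hr|sg [dec1 prop1]] :=
    @refine _ Q 1 (fun d _ => pdist d / scale d) 1 decQ propQ.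
  apply: norm_le; first lra.
  by rewrite /dot big_ord_recl big_ord0; nra.
have [d [/scl t0 _]|u [dec2 prop2]] :=
    @refine _ _ n (fun d => vscal (/ scale d) (vsub (pt d) xb)) 1 dec1 prop1.
  rewrite normZ_ge0; last by apply/Rlt_le/Rinv_0_lt_compat.
  apply: (Rmult_le_reg_l (scale d)) => //.
  rewrite -Rmult_assoc Rinv_r; last by lra.
  by rewrite /scale; have := pdist_ge0 d; lra.
have [d [[/badQ [_ [_ _ _ [_ _ n1 n2 _]]] _] _]|lam [_ prop3]] :=
    @refine _ _ _ mult (1 + Lam) dec2 prop2.
  by apply: Rle_trans (norm_blk _) _; lra.
have [s hs] := proper_seq prop3.
set sig := sg ord0.
have {hs}hs k : [/\ Q k (s k), Rabs (pdist (s k) / scale (s k) - sig) < eta k,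
    norm (vsub (vscal (/ scale (s k)) (vsub (pt (s k)) xb)) u) < eta k &
    norm (vsub (mult (s k)) lam) < eta k].
  have [[[? h] ?] ?] := hs k; split=> //.
  exact: Rle_lt_trans (coord_le_norm (vsub (fun _ => pdist (s k) / scale (s k)) sg) ord0) h.
pose t k := scale (s k).
have t0 k : 0 < t k by have [/scl] := hs k.
have te k : t k < 2 * eta k.
  have [/badQ [[Wk bx _ _] _] _ _ _] := hs k; have [_ h _ _] := hW Wk.
  by rewrite /t /scale /pdist; lra.
have dt : tdown t.
  split=> // e e0; have [N hN] := @eta_mul_small 2 e ltac:(lra) e0.
  by exists N => k /hN; have := te k; lra.
have sig0 : 0 <= sig.
  suff : - sig <= 0 by lra.
  apply: (@le_eta_le0 1); first lra.
  move=> k; have [/scl /ratio h1 h2 _ _] := hs k; move: h2.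
  by rewrite /Rabs; case: Rcase_abs => *; lra.
pose v := vscal sig w; set nw := norm w; have nw0 : 0 <= nw by apply: norm_ge0.
have hv k : norm (vsub (vsub (g (par (s k)) xb) yb) (vscal (t k) v)) <= t k * ((1 + nw) * eta k).
  have [[_ _ h1] h2 _ _] := hs k; have tk := t0 k; have p0 := pdist_ge0 (s k).
  have pt : pdist (s k) <= t k by rewrite /t /scale; have := norm_ge0 (vsub (pt (s k)) xb); lra.
  apply: Rle_trans (norm_sub_tri (vscal (pdist (s k)) w) _ _) _.
  have -> : vsub (vscal (pdist (s k)) w) (vscal (t k) v) =
      vscal (t k * (pdist (s k) / t k - sig)) w.
    apply: functional_extensionality => i; rewrite /v /vsub /vscal; field; lra.
  rewrite normZ Rabs_mult (Rabs_right (t k)); last lra.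
  have h3 := Rmult_le_compat_r _ _ _ (Rlt_le _ _ (eta_gt0 k)) pt.
  have h4 : t k * Rabs (pdist (s k) / t k - sig) * norm w <= t k * eta k * norm w.
    apply: Rmult_le_compat_r => //; apply: Rmult_le_compat_l; first lra.
    exact: Rlt_le.
  by rewrite -/nw in h4 *; lra.
have hu k : norm (vsub (vsub (pt (s k)) xb) (vscal (t k) u)) <= t k * eta k.
  have [_ _ h _] := hs k; have tk := t0 k.
  have -> : vsub (vsub (pt (s k)) xb) (vscal (t k) u) =
      vscal (t k) (vsub (vscal (/ t k) (vsub (pt (s k)) xb)) u).
    apply: functional_extensionality => i; rewrite /vsub /vscal; field; lra.
  by rewrite normZ_ge0; [apply: Rmult_le_compat_l | ]; try lra; apply: Rlt_le.
pose z k := vscal (/ t k) (vsub (im (s k)) yb).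
have imE k : vadd yb (vscal (t k) (z k)) = im (s k).
  have tk := t0 k; apply: functional_extensionality => i.
  by rewrite /z /vadd /vsub /vscal; field; lra.
have imE1 k : vadd (blk1 yb) (vscal (t k) (blk1 (z k))) = blk1 (im (s k)).
  by rewrite -imE.
have imE2 k : vadd (blk2 yb) (vscal (t k) (blk2 (z k))) = blk2 (im (s k)).
  by rewrite -imE.
set nA := mnorm A; have nA0 : 0 <= nA by apply: mnorm_ge0.
have cz : vconv z (vadd v (mv A u)).
  move=> e e0.
  (* [N1] is fixed before [k]: data of index [k] are known to lie within [3 * eta k] of [xb], but
     not within [delta k], so the linearization at [N1] is used once [3 * eta k < delta N1]. *)
  have [N1 /(_ N1 (leqnn _)) hN1] := @eta_mul_small 2 (e / 2) ltac:(lra) ltac:(lra).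
  have [N2 hN2] := @eta_mul_small (3 + nw + 2 * nA) (e / 2) ltac:(lra) ltac:(lra).
  have [N3 hN3] := @eta_mul_small 3 _ ltac:(lra) (delta0 N1).
  exists (maxn N1 (maxn N2 N3)) => k kN.
  have kN1 : (N1 <= k)%nat by apply: leq_trans kN; apply: leq_maxl.
  have {}hN2 : (3 + nw + 2 * nA) * eta k < e / 2.
    by apply: hN2; apply: leq_trans kN; rewrite !leq_max leqnn orbT.
  have {}hN3 : 3 * eta k < delta N1.
    by apply: hN3; apply: leq_trans kN; rewrite !leq_max leqnn !orbT.
  have tk := t0 k; have tek := te k; have ek := eta_gt0 k; have ek1 := eta_le1 k.
  have hvk := hv k; have huk := hu k.
  have [[[[Wk bx _ _] [h1 h2 _ _]] h3 _] _ _ _] := hs k.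
  rewrite -/(t k) in h1 h2 h3.
  have [lin _ _ _] := hW (decW kN1 Wk).
  have tke : t k * eta k <= t k * 1 by apply: Rmult_le_compat_l; lra.
  have tke' : t k * eta k <= 2 * eta k * 1 by apply: Rmult_le_compat; lra.
  have ptt : norm (vsub (pt (s k)) xb) <= t k by rewrite /t /scale; have := pdist_ge0 (s k); lra.
  have bxh := norm_sub_tri (pt (s k)) (pt' (s k)) xb.
  have xx : norm (vsub xb xb) = 0 by rewrite (_ : vsub xb xb = @vzero n) ?norm0 //; vec.
  have h4 := lin (pt' (s k)) xb ltac:(lra) ltac:(rewrite xx; have := delta0 N1; lra).
  have h5 : eta N1 * norm (vsub (pt' (s k)) xb) <= eta N1 * (2 * t k).
    by apply: Rmult_le_compat_l; [have := eta_gt0 N1; lra | lra].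
  apply: (Rmult_lt_reg_l (t k)) => //; rewrite -normZ_ge0; last lra.
  (* Five errors: projection, linearization, parameter direction, shift from [pt] to [pt'], point
     direction. All but the second add up to the factor [3 + nw + 2 * nA]. *)
  have -> : vscal (t k) (vsub (z k) (vadd v (mv A u))) =
    vadd (vsub (im (s k)) (g (par (s k)) (pt' (s k))))
    (vadd (vsub (vsub (g (par (s k)) (pt' (s k))) (g (par (s k)) xb)) (mv A (vsub (pt' (s k)) xb)))
    (vadd (vsub (vsub (g (par (s k)) xb) yb) (vscal (t k) v))
    (vadd (mv A (vsub (pt' (s k)) (pt (s k))))
          (mv A (vsub (vsub (pt (s k)) xb) (vscal (t k) u)))))).
    rewrite !mvB mvZ -[im (s k) in RHS]imE; vec.
  set b1 := vsub (im _) _; set b2 := vsub _ (mv _ _); set b3 := vsub _ (vscal _ v).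
  set b4 := mv _ _; set b5 := mv _ _.
  have t1 := norm_tri b1 (vadd b2 (vadd b3 (vadd b4 b5))).
  have t2 := norm_tri b2 (vadd b3 (vadd b4 b5)).
  have t3 := norm_tri b3 (vadd b4 b5); have t4 := norm_tri b4 b5.
  have b1h : norm b1 <= t k * eta k + t k * eta k by rewrite /b1 norm_subC; lra.
  have b4h := Rle_trans _ _ _ (mv_bound A _) (Rmult_le_compat_l _ _ _ nA0 h1).
  have b5h := Rle_trans _ _ _ (mv_bound A _) (Rmult_le_compat_l _ _ _ nA0 huk).
  have := Rmult_lt_compat_l _ _ _ tk hN1; have := Rmult_lt_compat_l _ _ _ tk hN2.
  by rewrite -/b4 in b4h; rewrite -/b5 in b5h; rewrite -/b2 in h4; rewrite -/b3 in hvk; lra.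
have cl : vconv (fun k => mult (s k)) lam.
  move=> e /eta_small [N hN]; exists N => k /hN lt; apply: Rlt_trans lt.
  by have [] := hs k.
exists v, u, lam; split.
- exact: im_deriv_scale.
(* With both limits zero, [pdist] and the displacement of [pt] would be small relative to [t N],
   which is their sum. *)
- move=> [v0 u0]; have [N /(_ N (leqnn _)) hN] := @eta_mul_small (2 + nw) 1 ltac:(lra) Rlt_0_1.
  have := hu N; have := hv N; have tN := t0 N; rewrite v0 u0.
  rewrite (_ : vsub (vsub (pt (s N)) xb) _ = vsub (pt (s N)) xb); last by vec.
  rewrite (_ : vsub (vsub (g (par (s N)) xb) yb) _ = vsub (g (par (s N)) xb) yb); last by vec.
  rewrite -/(pdist (s N)) => h1 h2.
  have : t N = pdist (s N) + norm (vsub (pt (s N)) xb) by [].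
  by have := Rmult_lt_compat_l _ _ _ tN hN; lra.
- exists t, z; split=> //; split=> // k; rewrite imE.
  by have [/badQ [_ []]] := hs k.
(* Index 0 suffices: the estimate there is strictly below 1, while the first block of [mult] has
   norm one. *)
- move=> l0; have [/badQ [_ [_ _ _ [_ _ n1 _ _]]] _ _ h] := hs 0%nat.
  have := norm_blk1 (vsub (mult (s 0%nat)) lam).
  rewrite -[blk1 (vsub _ _)]/(vsub (blk1 _) (blk1 _)) l0.
  rewrite (_ : vsub _ (@vzero l1) = blk1 (mult (s 0%nat))); last by vec.
  by have := eta_le1 0; lra.
have reg k : C (im (s k)) /\ reg_normal C1 (blk1 (im (s k))) (blk1 (mult (s k))) /\
    reg_normal C2 (blk2 (im (s k))) (blk2 (mult (s k))).
  by have [/badQ [_ [_ _ ? [? ? _ _ _]]] _ _ _] := hs k.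
split.
- exists t, (fun k => blk1 (z k)), (fun k => blk1 (mult (s k))).
  split=> //; split; first exact: vconv_blk1.
  split; first exact: (vconv_blk1 cl).
  by move=> k; rewrite imE1; have [[? ?] [? ?]] := reg k.
- exists t, (fun k => blk2 (z k)), (fun k => blk2 (mult (s k))).
  split=> //; split; first exact: vconv_blk2.
  split; first exact: (vconv_blk2 cl).
  by move=> k; rewrite imE2; have [[? ?] [? ?]] := reg k.
apply: norm_eq0; have [c [c0 hc]] := mtv_bound A.
apply: (@le_eta_le0 (3 + Lam + c)); first lra.
move=> k; have [/badQ [_ [_ _ _ [_ _ _ _ h1]]] _ _ h2] := hs k.
have := norm_le_sub (mtv A lam) (mtv A (mult (s k))); rewrite -mtvB => h3.
have := hc (vsub lam (mult (s k))); rewrite norm_subC => h4.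
rewrite norm_subC in h2.
have h5 := Rmult_le_compat_l _ _ _ c0 (Rlt_le _ _ h2).
by rewrite (norm_subC lam) in h4 h5; lra.
Qed.

End Stability.

Theorem theorem3p5 (P : Type) (T : topology P) (n l1 l2 : nat)
    (g : P -> vec n -> vec (l1 + l2)) (Dg : P -> vec n -> mat (l1 + l2) n)
    (C1 : vec l1 -> Prop) (C2 : vec l2 -> Prop)
    (pb : P) (xb : vec n) (zeta : P -> R) :
  let C := fun y : vec (l1 + l2) => C1 (blk1 y) /\ C2 (blk2 y) in
  let D := im_deriv g Dg zeta pb xb in
  let A := Dg pb xb in
  is_closed C1 -> is_closed C2 ->
  C (g pb xb) ->
  standing T g Dg pb xb ->
  cont_at T zeta pb ->
  (* (a) *)
  (forall v, D v -> forall t : nat -> R, tdown t ->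
     exists u : vec n,
       liminf_eq0 (fun k => setdist (vadd (g pb xb) (vscal (t k) (vadd v (mv A u)))) C / t k)) ->
  (* (b) *)
  robinson_stable T (fun p x => blk2 (g p x)) C2 pb xb ->
  (* (c) *)
  (forall (v : vec (l1 + l2)) (u : vec n), D v ->
     ~ (v = @vzero (l1 + l2) /\ u = @vzero n) ->
     contingent C (g pb xb) (vadd v (mv A u)) ->
     forall lam : vec (l1 + l2),
       dir_normal C1 (blk1 (g pb xb)) (blk1 (vadd v (mv A u))) (blk1 lam) ->
       dir_normal C2 (blk2 (g pb xb)) (blk2 (vadd v (mv A u))) (blk2 lam) ->
       mtv A lam = @vzero n ->
       blk1 lam = @vzero l1) ->
  robinson_stable T g C pb xb.
Proof.
move=> C D A cl1 cl2 Cyb st cz aubin rob dual; apply: NNPP => unst.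
have [W [delta [R0 [L [K [R00 L0 K0 d0 [nW decW hW lip reg]]]]]]] :=
  uniform_neighborhoods Cyb st cz rob.
have prop := bad_nonvoid cl1 cl2 Cyb R00 L0 K0 d0 nW decW hW lip reg unst.
have [w [Dw Qw]] := small_residual Cyb R00 L0 K0 d0 decW hW lip reg aubin prop.
have [v [u [lam [Dv vu tan l0 [d1 d2 crit]]]]] := limit_multiplier L0 K0 d0 decW hW Dw Qw.
exact/l0/(dual v u).
Qed.
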